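(* Let $A=\{a_1,a_2,\dots,a_n\}$ with $n\geq 2$, let $u,v\in A^*$ with $|v|\leq|u|\leq 3$, and let $S=sgp\langle A\mid u=v\rangle$. Then: (1) If there do not exist distinct letters $a,b\in A$ such that the relation $u=v$ is (letter for letter) one of $aba=ba$, $aab=ba$, $abb=bb$, then $S$ is prefix-automatic. If there exist distinct letters $a,b\in A$ such that $u=v$ is one of $aba=ba$, $aab=ba$, $abb=bb$, then $S$ is not automatic. (2) $S$ is biautomatic if one of the following holds: (i) $|u|=3$ and $|v|=0$; (ii) $|u|=|v|=3$; (iii) $|u|=2$ and there do not exist distinct letters $a,b\in A$ such that $u=v$ is one of $ab=a$, $ab=b$. If $|u|=2$ and there exist distinct $a,b\in A$ such that $u=v$ is one of $ab=a$, $ab=b$, then $S$ is not biautomatic.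
   Context: For a finite alphabet $A$, $A^*$ is the free monoid on $A$ (empty word $\varepsilon$), $A^+=A^*\setminus\{\varepsilon\}$, and $|w|$ is the length of $w$. $sgp\langle A\mid R\rangle$ denotes the monoid $A^*$ modulo the congruence generated by the relations $R$; $sgp^+\langle A\mid R\rangle$ denotes the semigroup $A^+$ modulo the congruence generated by $R$. A language is regular if it is accepted by a finite state automaton. Let $\$\notin A$ and $A(2,\$)=(A\cup\{\$\})^2\setminus\{(\$,\$)\}$. For $\alpha,\beta\in A^*$, $(\alpha,\beta)\delta_A^R$ is the word over $A(2,\$)$ obtained by padding the shorter of $\alpha,\beta$ on the right with $\$$'s to equal length and reading off the pairs of letters position by position; $(\alpha,\beta)\delta_A^L$ is defined the same way but padding on the left. Let $S$ be a semigroup generated by a finite set $A$, $\phi:A^+\to S$ the canonical epimorphism, and $L\subseteq A^+$ a regular language with $\phi(L)=S$; write $\alpha=\beta$ if $\phi(\alpha)=\phi(\beta)$ (with $\alpha\varepsilon\equiv\alpha$). For $a\in A\cup\{\varepsilon\}$ put $L_a^\$=\{(\alpha,\beta)\delta^R_A:\alpha,\beta\in L,\ \alpha a=\beta\}$, ${}^\$L_a=\{(\alpha,\beta)\delta^L_A:\alpha,\beta\in L,\ \alpha a=\beta\}$, ${}_aL^\$=\{(\alpha,\beta)\delta^R_A:\alpha,\beta\in L,\ a\alpha=\beta\}$, ${}^\$_aL=\{(\alpha,\beta)\delta^L_A:\alpha,\beta\in L,\ a\alpha=\beta\}$. $(A,L)$ is an automatic structure if $L_a^\$$ is regular for every $a\in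 A\cup\{\varepsilon\}$, and a biautomatic structure if all four of $L_a^\$,{}^\$L_a,{}_aL^\$,{}^\$_aL$ are regular for every $a\in A\cup\{\varepsilon\}$. $(A,L)$ is a prefix-automatic structure if it is an automatic structure and $\{(\alpha,\beta)\delta_A^R:\alpha\in L,\ \beta\in\mathrm{Pref}(L),\ \alpha=\beta\}$ is regular, where $\mathrm{Pref}(L)$ is the set of prefixes of words of $L$. A semigroup is automatic (biautomatic, prefix-automatic) if it admits such a structure for some finite generating set; a monoid is called automatic (biautomatic, prefix-automatic) if it is so as a semigroup. *)

(* Defs.v *)
From mathcomp Require Import all_boot.
From Stdlib Require Import Relations.

Set Implicit Arguments.
Unset Strict Implicit.
Unset Printing Implicit Defensive.

Definition dfa_accepts (Σ : finType) (k : nat) (d : 'I_k -> Σ -> 'I_k)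
  (q0 : 'I_k) (F : pred 'I_k) (w : seq Σ) : bool :=
  F (foldl d q0 w).

Definition regular (Σ : finType) (L : seq Σ -> Prop) : Prop :=
  exists (k : nat) (q0 : 'I_k) (d : 'I_k -> Σ -> 'I_k) (F : pred 'I_k),
    forall w, L w <-> dfa_accepts d q0 F w.

(* The padding symbol $ is [None]; letters are [Some x]. *)

Definition padR (X : Type) (s t : seq X) : seq (option X * option X) :=
  [seq (nth None (map Some s) i, nth None (map Some t) i)
     | i <- iota 0 (maxn (size s) (size t))].

Definition padL (X : Type) (s t : seq X) : seq (option X * option X) :=
  rev (padR (rev s) (rev t)).

Definition oseq (X : Type) (a : option X) : seq X :=
  if a is Some x then [:: x] else [::].

(* The semigroup is A^* modulo [eqS]. A finite generating set is given by
   m elements of S, represented by words [g b] over A (pairwise distinct in S);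
   the canonical epimorphism B^+ -> S is [ev g]. *)
Definition ev (A : Type) (m : nat) (g : 'I_m -> seq A) (w : seq 'I_m) : seq A :=
  flatten (map g w).

Definition base_structure (A : Type) (eqS : seq A -> seq A -> Prop)
  (m : nat) (g : 'I_m -> seq A) (L : seq 'I_m -> Prop) : Prop :=
  [/\ (forall b c : 'I_m, eqS (g b) (g c) -> b = c),
      (forall w, L w -> w <> [::]),
      regular L
    & (forall x : seq A, exists w, L w /\ eqS (ev g w) x)].

Definition L_right_padR (A : Type) (eqS : seq A -> seq A -> Prop)
  (m : nat) (g : 'I_m -> seq A) (L : seq 'I_m -> Prop) (a : option 'I_m)
  (w : seq (option 'I_m * option 'I_m)) : Prop :=
  exists al be, [/\ L al, L be, eqS (ev g (al ++ oseq a)) (ev g be)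
                  & w = padR al be].

Definition L_right_padL (A : Type) (eqS : seq A -> seq A -> Prop)
  (m : nat) (g : 'I_m -> seq A) (L : seq 'I_m -> Prop) (a : option 'I_m)
  (w : seq (option 'I_m * option 'I_m)) : Prop :=
  exists al be, [/\ L al, L be, eqS (ev g (al ++ oseq a)) (ev g be)
                  & w = padL al be].

Definition L_left_padR (A : Type) (eqS : seq A -> seq A -> Prop)
  (m : nat) (g : 'I_m -> seq A) (L : seq 'I_m -> Prop) (a : option 'I_m)
  (w : seq (option 'I_m * option 'I_m)) : Prop :=
  exists al be, [/\ L al, L be, eqS (ev g (oseq a ++ al)) (ev g be)
                  & w = padR al be].

Definition L_left_padL (A : Type) (eqS : seq A -> seq A -> Prop)
  (m : nat) (g : 'I_m -> seq A) (L : seq 'I_m -> Prop) (a : option 'I_m)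
  (w : seq (option 'I_m * option 'I_m)) : Prop :=
  exists al be, [/\ L al, L be, eqS (ev g (oseq a ++ al)) (ev g be)
                  & w = padL al be].

Definition automatic_structure (A : Type) (eqS : seq A -> seq A -> Prop)
  (m : nat) (g : 'I_m -> seq A) (L : seq 'I_m -> Prop) : Prop :=
  base_structure eqS g L /\
  forall a : option 'I_m, regular (L_right_padR eqS g L a).

Definition biautomatic_structure (A : Type) (eqS : seq A -> seq A -> Prop)
  (m : nat) (g : 'I_m -> seq A) (L : seq 'I_m -> Prop) : Prop :=
  base_structure eqS g L /\
  forall a : option 'I_m,
    [/\ regular (L_right_padR eqS g L a), regular (L_right_padL eqS g L a),
        regular (L_left_padR eqS g L a) & regular (L_left_padL eqS g L a)].

(* {(α,β)δ^R : α ∈ L, β ∈ Pref(L), α = β}; β ranges over nonempty prefixes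
   (φ is only defined on B^+). *)
Definition prefix_language (A : Type) (eqS : seq A -> seq A -> Prop)
  (m : nat) (g : 'I_m -> seq A) (L : seq 'I_m -> Prop)
  (w : seq (option 'I_m * option 'I_m)) : Prop :=
  exists al be, [/\ L al, be <> [::], (exists s, L (be ++ s)),
                    eqS (ev g al) (ev g be) & w = padR al be].

Definition prefix_automatic_structure (A : Type) (eqS : seq A -> seq A -> Prop)
  (m : nat) (g : 'I_m -> seq A) (L : seq 'I_m -> Prop) : Prop :=
  automatic_structure eqS g L /\ regular (prefix_language eqS g L).

Definition automatic (A : Type) (eqS : seq A -> seq A -> Prop) : Prop :=
  exists (m : nat) (g : 'I_m -> seq A) (L : seq 'I_m -> Prop),
    automatic_structure eqS g L.

Definition biautomatic (A : Type) (eqS : seq A -> seq A -> Prop) : Prop :=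
  exists (m : nat) (g : 'I_m -> seq A) (L : seq 'I_m -> Prop),
    biautomatic_structure eqS g L.

Definition prefix_automatic (A : Type) (eqS : seq A -> seq A -> Prop) : Prop :=
  exists (m : nat) (g : 'I_m -> seq A) (L : seq 'I_m -> Prop),
    prefix_automatic_structure eqS g L.

Inductive rel_step (A : Type) (u v : seq A) : seq A -> seq A -> Prop :=
  | RelStep : forall x y, rel_step u v (x ++ u ++ y) (x ++ v ++ y).

Definition pres_cong (A : Type) (u v : seq A) : seq A -> seq A -> Prop :=
  clos_refl_sym_trans (seq A) (rel_step u v).

Definition bad_rel1 (n : nat) (u v : seq 'I_n) : Prop :=
  exists a b : 'I_n, a <> b /\
    [\/ (u = [:: a; b; a] /\ v = [:: b; a]),
        (u = [:: a; a; b] /\ v = [:: b; a])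
      | (u = [:: a; b; b] /\ v = [:: b; b])].

Definition bad_rel2 (n : nat) (u v : seq 'I_n) : Prop :=
  exists a b : 'I_n, a <> b /\
    ((u = [:: a; b] /\ v = [:: a]) \/ (u = [:: a; b] /\ v = [:: b])).

(* Main.v *)
(* Up to renaming the letters there are finitely many relations u = v. Each of
   the non-exceptional ones has a presentation by a finite complete rewriting
   system, possibly after adding a generator that abbreviates a short word; in
   most cases the single rule u -> v or v -> u suffices. Let L be the set of
   irreducible words, which is closed under prefixes and represents every
   element once. For al in L, the irreducible form of al x is computed from
   right to left by a transducer that carries a word of bounded length and
   keeps bounded the delay between input and output; hence the multiplication
   by x is recognised by a finite automaton reading the padded pairs. The
   rewriting systems and the transducers are verified by computation, and left
   multiplication is treated by reversing all words.

   In the exceptional cases, arbitrarily long words are collapsed by one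
   multiplication, which is refuted by pumping: aba = ba and abb = bb give
   words a^i w_j with a^i w_j y independent of i, aab = ba gives
   a^(2^m) b^m = b^m a, so that word lengths would have to be both exponential
   and linear in m, and ab = b gives b^m a^k b = b^(m+1), which is not
   recognisable with padding on the left. *)
Require Import Defs.
From mathcomp Require Import all_boot zify.
From Stdlib Require Import Relations ClassicalEpsilon.

Set Implicit Arguments.
Unset Strict Implicit.
Unset Printing Implicit Defensive.

(** * Regular languages *)

(** The recognising automata are not written down: a state is a pair of words of bounded length and
    a transition is an equality in the semigroup. Soundness then holds by construction, and the work
    is to find, for each correct pair, a run through short labels. The obstacle is direction: the
    product is computed from the right end of al, whereas columns are read from the left, and
    rewriting changes lengths, so that output letters face other input letters than those that
    produced them. An offset comparing the two lengths must stay bounded. Left padding needs it from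
    the start; with right padding it may stay undefined while there is no output, which allows a
    long word to collapse into the carry, as in b^i a^j b = b^(i+1) when ab = b. All checks run on
    words over natural numbers and only see the letters of the relation; any other letter of the
    alphabet occurs in no rule and blocks rewriting. Normalisation and state search are fuelled and
    not trusted: the properties they should ensure are tested afterwards. *)

Definition decide (P : Prop) : bool :=
  if excluded_middle_informative P then true else false.

Lemma decideP (P : Prop) : reflect P (decide P).
Proof. by rewrite /decide; case: excluded_middle_informative => h; constructor. Qed.

Lemma regular_finType (T Q : finType) (q0 : Q) (d : Q -> T -> Q) (F : pred Q)
    (L : seq T -> Prop) :
  (forall w, L w <-> F (foldl d q0 w)) -> regular L.
Proof.
move=> H; exists #|Q|, (enum_rank q0),
  (fun q a => enum_rank (d (enum_val q) a)), (fun q => F (enum_val q)) => w.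
rewrite H /dfa_accepts; suff -> : foldl (fun q a => enum_rank (d (enum_val q) a))
  (enum_rank q0) w = enum_rank (foldl d q0 w) by rewrite enum_rankK.
by elim: w q0 {H} => //= a w IH q0; rewrite enum_rankK IH.
Qed.

Lemma eq_regular (T : finType) (L L' : seq T -> Prop) :
  (forall w, L w <-> L' w) -> regular L -> regular L'.
Proof.
by move=> e [k [q0 [d [F H]]]]; exists k, q0, d, F => w; rewrite -e H.
Qed.

Lemma regularI (T : finType) (L L' : seq T -> Prop) :
  regular L -> regular L' -> regular (fun w => L w /\ L' w).
Proof.
move=> [k [q0 [d [F H]]]] [k' [q0' [d' [F' H']]]].
apply: (@regular_finType _ ('I_k * 'I_k')%type (q0, q0')
  (fun q a => (d q.1 a, d' q.2 a)) (fun q => F q.1 && F' q.2)) => w.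
rewrite H H' /dfa_accepts.
have -> : foldl (fun (q : 'I_k * 'I_k') a => (d q.1 a, d' q.2 a)) (q0, q0') w
  = (foldl d q0 w, foldl d' q0' w) by elim: w q0 q0' {H H'} => //=.
by split=> [[-> ->]|/andP].
Qed.

(** Applied to the two projections of a column, whose [None] is the padding symbol: a regular
    condition on one component is regular on padded pairs. *)
Lemma regular_preim_pmap (T T' : finType) (h : T -> option T')
    (L : seq T' -> Prop) :
  regular L -> regular (fun w => L (pmap h w)).
Proof.
move=> [k [q0 [d [F H]]]].
exists k, q0, (fun q a => if h a is Some b then d q b else q), F => w.
rewrite H /dfa_accepts; suff -> : foldl d q0 (pmap h w) =
  foldl (fun q a => if h a is Some b then d q b else q) q0 w by [].
by elim: w q0 {H} => //= a w IH q0; case: (h a) => //=.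
Qed.

Fixpoint nfa_run (T Q : Type) (D : Q -> T -> Q -> Prop) (F : Q -> Prop)
    (q : Q) (w : seq T) : Prop :=
  if w is a :: w' then exists q', D q a q' /\ nfa_run D F q' w' else F q.

(** Subset construction for arbitrary propositions [I], [F], [D]: the transitions used later are
    equalities in the semigroup, so membership in a set of states is settled by [decide]. *)
Lemma regular_nfa (T Q : finType) (I F : Q -> Prop) (D : Q -> T -> Q -> Prop)
    (L : seq T -> Prop) :
  (forall w, L w <-> exists q, I q /\ nfa_run D F q w) -> regular L.
Proof.
move=> H.
pose d (X : {set Q}) a := [set q' | [exists q in X, decide (D q a q')]].
apply: (@regular_finType _ {set Q} [set q | decide (I q)] d
  (fun X => [exists q in X, decide (F q)])) => w; rewrite H.
suff E X : [exists q in foldl d X w, decide (F q)] <->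
           exists q, q \in X /\ nfa_run D F q w.
  rewrite E; split=> -[q [hq r]]; exists q; split=> //; move: hq;
    by rewrite inE => /decideP.
elim: w X {H} => [|a w IH] X /=.
  by split=> [/exists_inP[q qX /decideP Fq]|[q [qX Fq]]];
    [exists q | apply/exists_inP; exists q => //; apply/decideP].
rewrite IH; split.
  move=> [q' [+ r]]; rewrite inE => /exists_inP[q qX /decideP Dq].
  by exists q; split=> //; exists q'.
move=> [q [qX [q' [Dq r]]]]; exists q'; split=> //; rewrite inE.
by apply/exists_inP; exists q => //; apply/decideP.
Qed.

Lemma regular_rev (T : finType) (L : seq T -> Prop) :
  regular L -> regular (fun w => L (rev w)).
Proof.
move=> [k [q0 [d [F H]]]].
apply: (@regular_nfa _ 'I_k (fun q => F q) (fun q => q = q0)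
  (fun q a q' => d q' a = q)) => w; rewrite H /dfa_accepts.
have E q : nfa_run (fun q a q' => d q' a = q) (fun q => q = q0) q w <->
           q = foldl d q0 (rev w).
  elim: w q => [//|a w IH] q; rewrite rev_cons -cats1 foldl_cat /=.
  split=> [[q' [<- /IH ->]] //|->].
  by exists (foldl d q0 (rev w)); split=> //; apply/IH.
by split=> [h|[q [Fq /E <-]] //]; exists (foldl d q0 (rev w)); split=> //; apply/E.
Qed.

(** * Padded pairs *)

Section Pad.
Variable X : Type.
Implicit Types s t : seq X.

Lemma padR_nil : padR [::] [::] = [::] :> seq (option X * option X).
Proof. by []. Qed.

Lemma padR_cons a b s t : padR (a :: s) (b :: t) = (Some a, Some b) :: padR s t.
Proof.
rewrite /padR /= maxnSS /=; congr (_ :: _).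
by rewrite -[1]addn0 iotaDl -map_comp.
Qed.

Lemma padR_consl a s : padR (a :: s) [::] = (Some a, None) :: padR s [::].
Proof.
rewrite /padR /= !maxn0 /=; congr (_ :: _).
by rewrite -[1]addn0 iotaDl -map_comp; apply: eq_map => i; rewrite /= !nth_nil.
Qed.

Lemma padR_consr b t : padR [::] (b :: t) = (None, Some b) :: padR [::] t.
Proof.
rewrite /padR /= !max0n /=; congr (_ :: _).
by rewrite -[1]addn0 iotaDl -map_comp; apply: eq_map => i; rewrite /= !nth_nil.
Qed.

Definition padRE := (padR_nil, padR_cons, padR_consl, padR_consr).

Lemma padR_proj s t : pmap fst (padR s t) = s /\ pmap snd (padR s t) = t.
Proof.
elim: s t => [|a s IH] [|b t]; rewrite ?padRE //=.
- by elim: t b => [|c t IH] b; rewrite ?padRE //=; have [-> /= [->]] := IH c.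
- by have [-> ->] := IH [::].
- by have [-> ->] := IH t.
Qed.

Lemma padL_proj s t : pmap fst (padL s t) = s /\ pmap snd (padL s t) = t.
Proof.
have prev Y Z (h : Y -> option Z) w : pmap h (rev w) = rev (pmap h w).
  elim: w => //= y w IH; rewrite rev_cons -cats1 pmap_cat IH /=.
  by case: (h y) => [z|] /=; rewrite ?cats0 // rev_cons -cats1.
rewrite /padL !prev; have [-> ->] := padR_proj (rev s) (rev t).
by rewrite !revK.
Qed.

End Pad.

Section PadRegular.
Variable T : finType.
Implicit Types (s t : seq T) (w : seq (option T * option T)).

(** The state records which components have ended; an ended one stays padded, and the column of two
    padding symbols is excluded. *)
Definition pad_trans (q : bool * bool) (a : option T * option T) q' :=
  [/\ a.1 || a.2 : bool, q.1 ==> ~~ a.1, q.2 ==> ~~ a.2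
    & q' = (~~ a.1, ~~ a.2)].

Lemma padR_valid s t :
  nfa_run pad_trans (fun=> True) (s == [::], t == [::]) (padR s t).
Proof.
elim: s t => [|a s IH] t; last first.
  case: t => [|b t]; rewrite !padRE /=.
    by exists (false, true); split=> //; case: s IH => [|c s] IH; [exact: I|exact: (IH [::])].
  exists (false, false); split=> //; have := IH t.
  by case: s {IH} => [|c s]; case: t => [|e t] //=; rewrite !padRE /= => -[q' [[h1 h2 h3 ->] h]];
    eexists; (split; last exact: h).
have E e1 u : nfa_run pad_trans (fun=> True) (e1, false) (padR [::] u).
  elim: u e1 => [|c u IH] e1; rewrite ?padRE //=; exists (true, false).
  by split=> //; rewrite /pad_trans /= implybT.
by case: t => [|c t] //; exact: E.
Qed.

Lemma valid_padR q w : nfa_run pad_trans (fun=> True) q w ->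
  [/\ w = padR (pmap fst w) (pmap snd w), q.1 -> pmap fst w = [::]
    & q.2 -> pmap snd w = [::]].
Proof.
elim: w q => [|[a b] w IH] [e1 e2] //= [q' [[/= h1 h2 h3 ->] /IH [ew e1' e2']]].
case: a b h1 h2 h3 e1' e2' => [a|] [b|] //= _ h2 h3 e1' e2'.
- by split; [rewrite padR_cons -ew | move=> h; rewrite h in h2 | move=> h; rewrite h in h3].
- by rewrite (e2' isT) in ew *; split; [rewrite padR_consl -ew | move=> h; rewrite h in h2 |].
- by rewrite (e1' isT) in ew *; split; [rewrite padR_consr -ew | | move=> h; rewrite h in h3].
Qed.

Lemma regular_padR (L L' : seq T -> Prop) : regular L -> regular L' ->
  regular (fun w => exists s t, [/\ L s, L' t & w = padR s t]).
Proof.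
move=> rL rL'.
have rv : regular (fun w => nfa_run pad_trans (fun=> True) (false, false) w).
  apply: (@regular_nfa _ (bool * bool)%type (fun q => q = (false, false))
    (fun=> True) pad_trans) => w.
  by split=> [h|[q [-> //]]]; exists (false, false).
have r1 := @regular_preim_pmap (option T * option T)%type T fst L rL.
have r2 := @regular_preim_pmap (option T * option T)%type T snd L' rL'.
apply: eq_regular (regularI rv (regularI r1 r2)) => w; split.
  by move=> [/valid_padR[ew _ _] [l1 l2]]; exists (pmap fst w), (pmap snd w).
move=> [s [t [hs ht ->]]]; have [-> ->] := padR_proj s t.
split=> //; have := padR_valid s t.
case: s t {hs ht} => [|a s] [|b t] //=; rewrite !padRE /= => -[q' [[h1 h2 h3 ->] h]];
  by eexists; split; last exact: h.
Qed.

Lemma regular_padL (L L' : seq T -> Prop) : regular L -> regular L' ->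
  regular (fun w => exists s t, [/\ L s, L' t & w = padL s t]).
Proof.
move=> rL rL'.
have := regular_rev (regular_padR (regular_rev rL) (regular_rev rL')).
apply: eq_regular => w; split=> -[s [t [hs ht e]]].
  by exists (rev s), (rev t); split=> //; rewrite /padL !revK -e revK.
by exists (rev s), (rev t); rewrite !revK; split=> //; rewrite e /padL revK.
Qed.

End PadRegular.

(** * Carry automata *)

Definition congruence (C : Type) (E : seq C -> seq C -> Prop) : Prop :=
  [/\ forall x, E x x, forall x y, E x y -> E y x,
      forall x y z, E x y -> E y z -> E x z
    & forall p s x y, E x y -> E (p ++ x ++ s) (p ++ y ++ s)].

Section Carry.
Variables (C : finType) (E : seq C -> seq C -> Prop).
Hypothesis congE : congruence E.

Let Erefl x : E x x. Proof. by case: congE. Qed.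
Hint Resolve Erefl : core.
Let Esym x y : E x y -> E y x. Proof. by case: congE => _ h _ _; apply: h. Qed.
Let Etrans x y z : E x y -> E y z -> E x z.
Proof. by case: congE => _ _ h _; apply: h. Qed.
Let Ecat x y x' y' : E x y -> E x' y' -> E (x ++ x') (y ++ y').
Proof.
case: congE => _ _ _ h e e'; apply: Etrans (_ : E (y ++ x') _).
  exact: (h [::] x' _ _ e).
by have := h y [::] _ _ e'; rewrite !cats0.
Qed.

(* A label (c, d) reached after reading the prefixes al1 and be1 records
   that al1 c = be1 d holds in the semigroup. *)
Fixpoint carry_run (K : nat) (x c d : seq C) (cols : seq (seq C * seq C)) : Prop :=
  if cols is (a, b) :: cols' then
    exists c' d' z, [/\ size c' <= K, size d' <= K, E (a ++ c') (c ++ z),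
      E (b ++ d') (d ++ z) & carry_run K x c' d' cols']
  else c = x /\ d = [::].

(** One column extends X c = Y d to X a c' = X c z = Y d z = Y b d'. *)
Lemma carry_run_sound K x c d cols X Y :
  carry_run K x c d cols -> E (X ++ c) (Y ++ d) ->
  E (X ++ flatten (map fst cols) ++ x) (Y ++ flatten (map snd cols)).
Proof.
elim: cols X Y c d => [|[a b] cols IH] X Y c d /=.
  by move=> [-> ->]; rewrite !cats0.
move=> [c' [d' [z [_ _ ea eb r]]]] e.
have := IH (X ++ a) (Y ++ b) c' d' r; rewrite -!catA; apply.
apply: Etrans (Ecat (Erefl X) ea) _; rewrite catA.
apply: Etrans (Ecat e (Erefl z)) _; rewrite -catA.
by apply: Esym; apply: Ecat.
Qed.

Variables (B : finType) (val : B -> seq C).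

Definition oval (a : option B) : seq C := if a is Some b then val b else [::].
Definition colval (p : option B * option B) := (oval p.1, oval p.2).
Definition vals (w : seq B) : seq C := flatten (map val w).

Lemma flatten_oval (T : Type) (h : T -> option B) w :
  flatten (map (oval \o h) w) = vals (pmap h w).
Proof. by elim: w => //= a w ->; case: (h a). Qed.

(** Only the labels are bounded: z is quantified inside the transition and does not enter the state.
    Before the first column both prefixes are empty, so any label (c, c) may start. *)
Lemma regular_carry_run K x :
  regular (fun w => exists c, size c <= K /\ carry_run K x c c (map colval w)).
Proof.
pose Q := ({bseq K of C} * {bseq K of C})%type.
pose D (q : Q) (a : option B * option B) (q' : Q) := exists z,
  E (oval a.1 ++ q'.1) (q.1 ++ z) /\ E (oval a.2 ++ q'.2) (q.2 ++ z).
pose F (q : Q) := q.1 = x :> seq C /\ q.2 = [::] :> seq C.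
apply: (@regular_nfa _ Q (fun q => q.1 = q.2) F D) => w.
have eq q : nfa_run D F q w <-> carry_run K x q.1 q.2 (map colval w).
  elim: w q => [|a w IH] q //=; split.
    move=> [q' [[z [ea eb]] /IH r]]; exists q'.1, q'.2, z.
    by split=> //; apply: size_bseq.
  move=> [c' [d' [z [hc hd ea eb r]]]]; exists (Bseq hc, Bseq hd).
  by split; [exists z | apply/IH].
split=> [[c [hc r]]|[q [e /eq]]].
  by exists (Bseq hc, Bseq hc); split=> //; apply/eq.
by rewrite -e => r; exists q.1; split=> //; apply: size_bseq.
Qed.

(** Soundness of runs gives one inclusion for free; a bounded run has to be supplied only for pairs
    already known to be correct. *)
Lemma regular_right_pad
    (pad : seq B -> seq B -> seq (option B * option B)) (L : seq B -> Prop) K x :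
  (forall s t, pmap fst (pad s t) = s /\ pmap snd (pad s t) = t) ->
  regular (fun w => exists s t, [/\ L s, L t & w = pad s t]) ->
  (forall s t, L s -> L t -> E (vals s ++ x) (vals t) ->
     exists c, size c <= K /\ carry_run K x c c (map colval (pad s t))) ->
  regular (fun w => exists s t,
    [/\ L s, L t, E (vals s ++ x) (vals t) & w = pad s t]).
Proof.
move=> projP rpad H.
apply: eq_regular (regularI rpad (regular_carry_run K x)) => w; split.
  move=> [[s [t [hs ht ->]]] [c [hc r]]]; exists s, t; split=> //.
  have := @carry_run_sound _ _ _ _ _ [::] [::] r (Erefl c).
  rewrite -!map_comp /= (flatten_oval fst) (flatten_oval snd).
  by have [-> ->] := projP s t.
move=> [s [t [hs ht e ->]]]; split; first by exists s, t.
exact: H.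
Qed.

End Carry.

(** * Runs obtained from a right-to-left computation of the product *)

Section Chain.
Variables (C : finType) (E : seq C -> seq C -> Prop).
Hypothesis congE : congruence E.
Let Erefl x : E x x. Proof. by case: congE. Qed.
Hint Resolve Erefl : core.
Let Ecatr x y z : E x y -> E (x ++ z) (y ++ z).
Proof. by case: congE => _ _ _ h e; apply: (h [::]). Qed.

Variables (K B : nat) (x : seq C) (r0 : option nat).

(* [chain al d out r]: processing al from right to left, starting from the
   carry x, leaves the carry d and the output out, so that al x = d out.
   [r], when present, tracks |al| - |d| - |out| up to an additive constant. *)
Inductive chain : seq C -> seq C -> seq C -> option nat -> Prop :=
| Chain0 : chain [::] x [::] r0
| ChainS a al d out r d' o r' :
    chain al d out r -> E (a :: d) (d' ++ o) ->
    size d' <= K -> size o <= K.+1 ->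
    (if r' is Some m' then
       m' <= 2 * B /\ (if r is Some m then
         m' + size d' + size o = m + 1 + size d else True)
     else r = None /\ o = [::]) ->
    chain (a :: al) d' (o ++ out) r'.

(** [None] means that no output has been produced and that any number of letters may have been
    swallowed by the carry. The count starts, at any value up to 2B, no later than the output. *)
Definition offset_bounded (r : option nat) : bool :=
  if r is Some m then m <= 2 * B else true.

Hypothesis size_x : size x <= K.
Hypothesis size_r0 : offset_bounded r0.

Lemma chain_sound al d out r : chain al d out r -> E (al ++ x) (d ++ out).
Proof.
case: congE => _ _ tr cg.
elim=> [|a al' d1 out1 r1 d' o r' _ IH e _ _ _]; first by rewrite cats0.
rewrite cat_cons catA; apply: tr (_ : E ((a :: d1) ++ out1) _); last exact: Ecatr.
by have := cg [:: a] [::] _ _ IH; rewrite !cats0.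
Qed.

Lemma chain_bounds al d out r : chain al d out r ->
  [/\ size d <= K, offset_bounded r
    & r = None -> out = [::]].
Proof.
elim=> [|a al' d1 out1 r1 d' o r' _ [h1 h2 h3] e h4 h5]; first by split.
case: r' => [m' [h6 _]|[rN ->]]; first by split.
by split=> //= _; apply: h3.
Qed.

Definition cols (s t : seq C) : seq (seq C * seq C) :=
  map (colval (fun c => [:: c])) (padR s t).

Lemma cols_cons a b s t : cols (a :: s) (b :: t) = ([:: a], [:: b]) :: cols s t.
Proof. by rewrite /cols padRE. Qed.
Lemma cols_consl a s : cols (a :: s) [::] = ([:: a], [::]) :: cols s [::].
Proof. by rewrite /cols padRE. Qed.
Lemma cols_consr b t : cols [::] (b :: t) = ([::], [:: b]) :: cols [::] t.
Proof. by rewrite /cols padRE. Qed.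

Lemma carry_run_outs M c s d cs : size c <= M -> size (s ++ d) <= M ->
  carry_run E M x c d cs ->
  carry_run E M x c (s ++ d) (map (fun b => ([::], [:: b])) s ++ cs).
Proof.
move=> hc; elim: s => //= b s IH hs r; exists c, (s ++ d), [::].
by rewrite !cats0; split=> //; [lia | apply: IH => //; lia].
Qed.

(** [be] is the part of the product determined by the input read so far and [q] the number of
    columns read, so |be| - q is the lead of the computation over the reading head; [k] is constant
    along a run. Without an offset the output is empty and an upper bound on the lead is enough. *)
Definition aligned (r : option nat) (d be : seq C) q k : Prop :=
  match r with
  | Some m => size be + k = q + size d + m
  | None => size be <= q + 2 * K + 2 * B + 2
  end.

Let M := 4 * K + 4 * B + 4.

(** If p is the input already read, then p d = be, and the product is be out, of which q letters
    have been read. The label is (d, rest of be) while be is ahead of the head; when be lags behind,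
    the letters of out already read are appended to d. Alignment bounds lead and lag, whence the
    constant [M]. *)
Lemma carry_run_chain al d out r (be : seq C) q k :
  chain al d out r -> k <= 2 * B + 2 * K ->
  aligned r d be q k ->
  carry_run E M x (d ++ take (q - size be) out) (drop q be)
    (cols al (drop q (be ++ out))).
Proof.
move=> ch hk; elim: ch be q => [|a al1 d1 out1 r1 d' o r' ch IH e hd ho hr] be q.
  move=> hq /=; rewrite !cats0.
  suff hs : size (drop q be) <= M.
    elim: (drop q be) hs => [|b s IH] hs //; rewrite cols_consr.
    have hs' : size s <= M by exact: ltnW.
    exists x, s, [::]; rewrite !cats0; split=> //; last exact: IH.
    by rewrite /M; lia.
  by rewrite size_drop /M; case: r0 size_r0 hq => [m|]; rewrite /offset_bounded /aligned; lia.
move=> hq; have [hd1 hr1 oN] := chain_bounds ch; rewrite /offset_bounded in hr1.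
set qb := q.+1.
have hq' : aligned r1 d1 (be ++ o) qb k.
  rewrite /aligned size_cat /qb; move: hr hq hr1; rewrite /aligned; case: r' r1 {ch IH oN} => [m'|] [m|] //; try lia.
  - by move=> [].
  by move=> [_ ->] /=; lia.
have := IH (be ++ o) qb hq'; rewrite /aligned in hq'.
set c' := d1 ++ take (qb - _) out1; set e' := drop qb (be ++ o); move=> run'.
have hc' : size c' <= M.
  rewrite /c' size_cat size_take /M; case: r1 hr1 hq' oN {ch IH hr} => [m|] hr1 hq' oN.
    by case: ifP; lia.
  by rewrite (oN erefl) /=; lia.
have he' : size e' <= M.
  by rewrite /e' size_drop /M; case: r1 hr1 hq' {ch IH oN hr} => [m|]; lia.
have eo : o ++ take (q - size (be ++ o)) out1 =
          take (q - size be) (o ++ out1) ++ drop (q - size be) o.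
  rewrite size_cat subnDA take_cat; case: ltnP => h.
    have -> : q - size be - size o = 0 by lia.
    by rewrite take0 cats0 cat_take_drop.
  by rewrite (drop_oversize h) cats0.
have eb : drop q (be ++ o) = drop q be ++ drop (q - size be) o.
  rewrite drop_cat; case: ltnP => h; last by rewrite (drop_oversize h).
  by have -> : q - size be = 0 by [lia]; rewrite drop0.
(* The word z of the transition: the part of [o] beyond the q letters read, followed in the last
   case by the letter of [out1] read in this column. *)
have main z2 : take (qb - size (be ++ o)) out1 = take (q - size (be ++ o)) out1 ++ z2 ->
    E ([:: a] ++ c') ((d' ++ take (q - size be) (o ++ out1)) ++ drop (q - size be) o ++ z2).
  move=> ez; have -> : (d' ++ take (q - size be) (o ++ out1)) ++ drop (q - size be) o ++ z2
      = (d' ++ o) ++ (take (q - size (be ++ o)) out1 ++ z2).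
    by rewrite -!catA; congr (_ ++ _); rewrite !catA -eo.
  by rewrite /c' ez; apply: (Ecatr _ e).
case ebo: (drop q (be ++ o ++ out1)) => [|b rest].
  have hqs : size (be ++ o ++ out1) <= q.
    by have := size_drop q (be ++ o ++ out1); rewrite ebo /=; lia.
  rewrite cols_consl; exists c', e', (drop (q - size be) o ++ [::]); split=> //.
  - apply: main; rewrite cats0 !take_oversize //; move: hqs; rewrite /qb !size_cat; lia.
  - rewrite /= cats0 -eb /e' !drop_oversize //; move: hqs; rewrite /qb !size_cat; lia.
  - move: run'; rewrite -catA (@drop_oversize _ qb) //; rewrite /qb; lia.
have hqs : q < size (be ++ o ++ out1).
  by have := size_drop q (be ++ o ++ out1); rewrite ebo /=; lia.
have rest_eq : drop qb ((be ++ o) ++ out1) = rest.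
  by rewrite -catA /qb -add1n -drop_drop ebo /= drop0.
rewrite cols_cons -rest_eq.
case: (ltnP q (size (be ++ o))) => hqo.
  exists c', e', (drop (q - size be) o ++ [::]); split=> //.
    apply: main; rewrite cats0.
    by have -> : qb - size (be ++ o) = q - size (be ++ o) by rewrite /qb; lia.
  rewrite cats0 -eb /e'; move: ebo; rewrite catA drop_cat hqo.
  case eb2: (drop q (be ++ o)) => [|b2 t2] /=; last first.
    by move=> [<- _]; rewrite /qb -add1n -drop_drop eb2 /= drop0.
  by have := size_drop q (be ++ o); rewrite eb2 /=; lia.
exists c', e', (drop (q - size be) o ++ [:: b]); split=> //.
  apply: main; have -> : qb - size (be ++ o) = (q - size (be ++ o)).+1 by rewrite /qb; lia.
  move: ebo; rewrite catA drop_cat ltnNge hqo /= => ebo.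
  rewrite -addn1 takeD ebo /= take0 //.
by rewrite catA -eb /e' !drop_oversize //=; rewrite /qb; lia.
Qed.

Lemma carry_run_padR al d out r : chain al d out r ->
  exists c, size c <= M /\ carry_run E M x c c (cols al (d ++ out)).
Proof.
move=> ch; have [hd hr oN] := chain_bounds ch; exists d; split; first by rewrite /M; lia.
have := @carry_run_chain _ _ _ _ d 0 (if r is Some m then m else 0) ch.
rewrite sub0n take0 cats0 !drop0 /aligned; apply; first by case: r hr {ch oN} => [m|]; rewrite /offset_bounded; lia.
by case: r hr {ch oN} => [m|]; rewrite /offset_bounded; lia.
Qed.

Lemma chain_length al d out r : r0 != None -> chain al d out r ->
  exists m m0, [/\ r0 = Some m0, r = Some m, m <= 2 * B, m0 <= 2 * B &
    m + size d + size out = m0 + size x + size al].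
Proof.
case e0: r0 size_r0 => [m0|] //; rewrite /offset_bounded => hm0 _.
elim=> [|a al1 d1 out1 r1 d' o r' _ IH e _ _ hr].
  by exists m0, m0; rewrite /= !addn0; split.
have [m [_ [[<-] rm hm _ hs]]] := IH.
case: r' hr => [m'|] => [[hm' hr]|[]]; last by rewrite rm.
by exists m', m0; split=> //; move: hr; rewrite rm size_cat /=; lia.
Qed.

Lemma cols_padL_r s t1 t2 : size s = size t2 ->
  map (colval (fun c => [:: c])) (padL s (t1 ++ t2)) =
  map (fun b => ([::], [:: b])) t1 ++ cols s t2.
Proof.
move=> es; rewrite /padL /cols.
have rr u v p : size u = size v -> padR (u ++ rev [::]) (v ++ p) =
    padR u v ++ map (fun b : C => (None, Some b)) p.
  elim: u v => [|a u IH] [|b v] //= ; first by elim: p => // b p IH; rewrite padRE IH.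
  by move=> [e]; rewrite !padRE IH.
rewrite rev_cat -{1}[rev s]cats0 (rr _ _ (rev t1)) ?size_rev // rev_cat map_cat.
congr (_ ++ _); first by rewrite -map_rev revK -map_comp.
congr map; elim: s t2 es {rr} => [|a s IH] [|b t] //= [es].
rewrite !rev_cons padRE -IH // -!cats1.
have rc u v : size u = size v -> padR (u ++ [:: a]) (v ++ [:: b]) =
    rcons (padR u v) (Some a, Some b).
  by elim: u v => [|? u IHu] [|? v] //= [e]; rewrite !padRE IHu.
by rewrite rc ?size_rev // rev_rcons.
Qed.

Lemma cols_padL_l s1 s2 t : size s2 = size t ->
  map (colval (fun c => [:: c])) (padL (s1 ++ s2) t) =
  map (fun a => ([:: a], [::])) s1 ++ cols s2 t.
Proof.
have sw u v : padL u v = map (fun p => (p.2, p.1)) (padL v u).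
  rewrite /padL map_rev; congr rev; move: (rev u) (rev v) => {u v}.
  elim=> [|a u IH]; elim=> [|b v IHv] //; rewrite !padRE /= ?IH ?IHv //.
have sw2 u v : cols u v = map (fun p => (p.2, p.1)) (cols v u).
  rewrite /cols; elim: u v => [|a u IH]; elim=> [|b v IHv] //.
  - by rewrite !padRE /= IHv.
  - by rewrite !padRE /= IH.
  - by rewrite !padRE /= IH.
move=> es; rewrite sw -map_comp.
rewrite (@eq_map _ _ _ ((fun p => (p.2, p.1)) \o colval (fun c : C => [:: c]))) //.
by rewrite map_comp cols_padL_r // map_cat -sw2 -map_comp.
Qed.

(** In the surplus columns of the input no letter of the product is read, so the label keeps all of
    [be]. Its length is bounded because |be| + |out| = |al2|, while the offset controls |al1 ++ al2|
    - |d| - |out|. *)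
Lemma carry_run_chain_ins al1 al2 d out r (be : seq C) :
  r0 != None -> chain (al1 ++ al2) d out r -> size (be ++ out) = size al2 ->
  carry_run E M x d be
    (map (fun a => ([:: a], [::])) al1 ++ cols al2 (be ++ out)).
Proof.
move=> hr0; elim: al1 d out r be => [|a al1 IH] d out r be /= ch es.
  have [m [m0 [_ rm hm hm0 hs]]] := chain_length hr0 ch.
  have [hd _ _] := chain_bounds ch.
  have := @carry_run_chain _ _ _ _ be 0 (size d + m - size be) ch.
  rewrite sub0n take0 cats0 !drop0 /aligned; apply; first by lia.
  by rewrite rm; move: es hs; rewrite size_cat; lia.
have [m' [m0' [_ rm' hm' hm0' hs']]] := chain_length hr0 ch.
inversion ch as [|a' al' d1 out1 r1 d' o r' ch1 e hd ho hr]; subst.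
have [hd1 _ _] := chain_bounds ch1.
have [m [m0 [_ rm hm hm0 hs]]] := chain_length hr0 ch1.
exists d1, (be ++ o), o; split=> //; first by rewrite /M; lia.
  by move: es hs; rewrite !size_cat /M; lia.
by rewrite catA; apply: (IH _ _ _ _ ch1); rewrite -catA.
Qed.

(** With the offset tracked from the start, [al] and the product differ in length by a bounded
    amount. If the product is longer, its surplus is stored in the initial label and consumed by the
    columns without input; otherwise the surplus input is read first. *)
Lemma carry_run_padL al d out r : r0 != None -> chain al d out r ->
  exists c, size c <= M /\
    carry_run E M x c c (map (colval (fun c => [:: c])) (padL al (d ++ out))).
Proof.
move=> hr0 ch; have [m [m0 [_ rm hm hm0 hs]]] := chain_length hr0 ch.
have [hd _ _] := chain_bounds ch.
case: (leqP (size al) (size (d ++ out))) => hl.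
  set q := size (d ++ out) - size al.
  have hq : q <= 2 * B + K by move: hl; rewrite /q size_cat; lia.
  have := @carry_run_chain _ _ _ _ d q (q + m) ch.
  have hk : q + m <= 2 * B + 2 * K by move: hl; rewrite /q size_cat; lia.
  rewrite rm /aligned => /(_ hk) /(_ _) run.
  have {}run := run ltac:(lia).
  set c := d ++ take (q - size d) out in run.
  have hc : size c <= M.
    by rewrite /c size_cat size_take /M; case: ifP; lia.
  exists c; split=> //.
  have ec : c = take q (d ++ out) ++ drop q d.
    rewrite take_cat /c; case: ltnP => h; last by rewrite (drop_oversize h) cats0.
    by rewrite (_ : q - size d = 0) ?take0 ?cats0 ?cat_take_drop //; lia.
  rewrite -(cat_take_drop q (d ++ out)) cols_padL_r; last first.
    by rewrite size_drop /q; lia.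
  by rewrite {2}ec; apply: carry_run_outs => //; rewrite -ec.
exists d; split; first by rewrite /M; lia.
set p := size al - size (d ++ out).
rewrite -{1}(cat_take_drop p al) cols_padL_l; last by rewrite size_drop /p; lia.
apply: (@carry_run_chain_ins _ _ _ _ r) => //; first by rewrite cat_take_drop.
by rewrite size_drop /p; lia.
Qed.

End Chain.

(** * String rewriting *)

Section Rewriting.
Variable T : eqType.
Implicit Types (R : seq (seq T * seq T)) (w x y z l r p s : seq T).

Definition irreducible R w : bool := ~~ has (fun lr => infix lr.1 w) R.

Inductive rstep R : seq T -> seq T -> Prop :=
  RStep p s l r : (l, r) \in R -> rstep R (p ++ l ++ s) (p ++ r ++ s).

Definition red R := clos_refl_trans _ (rstep R).

Lemma red_cat R p s x y : red R x y -> red R (p ++ x ++ s) (p ++ y ++ s).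
Proof.
elim=> [x' y' [p' s' l r lr]|x'|x' y' z' _ h _ h'].
- have e u : p ++ (p' ++ u ++ s') ++ s = (p ++ p') ++ u ++ (s' ++ s)
    by rewrite -!catA.
  by rewrite !e; apply: rt_step; apply: RStep.
- exact: rt_refl.
- exact: rt_trans h h'.
Qed.

Lemma red_rule R p s l r : (l, r) \in R -> red R (p ++ l ++ s) (p ++ r ++ s).
Proof. by move=> h; apply: rt_step; apply: RStep. Qed.

Lemma occursP l w :
  reflect (exists i, i + size l <= size w /\ take (size l) (drop i w) = l)
          (infix l w).
Proof.
apply: (iffP (@infixP _ l w)) => [[p [s ->]]|[i [hi e]]].
  exists (size p); rewrite !size_cat drop_size_cat // take_size_cat //.
  by split=> //; lia.
exists (take i w), (drop (size l) (drop i w)).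
by rewrite -{1}e cat_take_drop cat_take_drop.
Qed.

Lemma irreducible_infix R w x : infix w x -> irreducible R x -> irreducible R w.
Proof.
move=> wx /hasPn h; apply/hasPn => lr /h; apply: contra => lw.
exact: infix_trans lw wx.
Qed.

Lemma irreducible_catl R x y : irreducible R (x ++ y) -> irreducible R x.
Proof. by apply: irreducible_infix; apply/infixP; exists [::], y. Qed.

Lemma irreducible_catr R x y : irreducible R (x ++ y) -> irreducible R y.
Proof. by apply: irreducible_infix; apply/infixP; exists x, [::]; rewrite cats0. Qed.

(** An occurrence of a left side not contained in [x ++ y] ends beyond it; having at most q+1
    letters, it starts no earlier than [y]. *)
Lemma irreducible_glue R q x y z : all (fun lr => size lr.1 <= q.+1) R ->
  irreducible R (x ++ y) -> irreducible R (y ++ z) -> q <= size y ->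
  irreducible R (x ++ y ++ z).
Proof.
move=> /allP hR /hasPn hx /hasPn hz hq; apply/hasPn => -[l r] lrR.
have {hR} /= hl := hR _ lrR; have {hx} /= hx := hx _ lrR.
have {hz} /= hz := hz _ lrR; apply/negP => /occursP[i [hi e]].
case: (leqP (i + size l) (size (x ++ y))) => h.
  case/negP: hx; apply/occursP; exists i; split=> //.
  rewrite -[RHS]e catA [in RHS]drop_cat; case: ltnP => h'; last first.
    by rewrite (_ : size l = 0) ?take0 //; lia.
  rewrite [in RHS]take_cat size_drop; case: ltnP => // h''.
  have -> : size l = size (x ++ y) - i by lia.
  by rewrite subnn take0 cats0 take_oversize // size_drop.
case/negP: hz; apply/occursP; exists (i - size x).
have hx' : size x <= i by move: h; rewrite size_cat; lia.
split; first by move: hi; rewrite !size_cat; lia.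
by rewrite -[RHS]e [in RHS]drop_cat ltnNge hx'.
Qed.

Lemma irreducible_sep R x y c : all (fun lr => c \notin lr.1) R ->
  irreducible R (rcons x c) -> irreducible R y -> irreducible R (rcons x c ++ y).
Proof.
move=> /allP hc /hasPn hx /hasPn hy; apply/hasPn => -[l r] lrR.
have {hc} /= hc := hc _ lrR; have {hx} /= hx := hx _ lrR.
have {hy} /= hy := hy _ lrR; apply/negP => /infixP[p [s e]].
case: (leqP (size (p ++ l)) (size (rcons x c))) => h1.
  case/negP: hx; apply/infixP; exists p, (drop (size (p ++ l)) (rcons x c)).
  have := congr1 (take (size (p ++ l))) e.
  by rewrite catA (take_size_cat _ (erefl _)) takel_cat // catA => e'; rewrite -{1}e' cat_take_drop.
case: (leqP (size (rcons x c)) (size p)) => h2.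
  case/negP: hy; apply/infixP; exists (drop (size (rcons x c)) p), s.
  have := congr1 (drop (size (rcons x c))) e.
  rewrite (drop_size_cat _ (erefl _)) drop_cat => ->.
  case: ltnP => // h3; have -> : size (rcons x c) = size p by lia.
  by rewrite subnn drop0 drop_size.
case/negP: hc.
have := congr1 (fun w => nth c w (size x)) e.
rewrite nth_cat size_rcons ltnSn nth_rcons ltnn eqxx nth_cat.
rewrite size_rcons in h1 h2; rewrite size_cat in h1.
have -> : (size x < size p) = false by lia.
rewrite nth_cat; have -> : size x - size p < size l by lia.
by move=> {1}->; apply: mem_nth; lia.
Qed.

Lemma irreducible_rcons R x c : all (fun lr => c \notin lr.1) R ->
  irreducible R x -> irreducible R (rcons x c).
Proof.
move=> /allP hc /hasPn hx; apply/hasPn => -[l r] lrR.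
have {hc} /= hc := hc _ lrR; have {hx} /= hx := hx _ lrR.
apply/negP => /infixP[p [s]]; case/lastP: s => [|s c'].
  case/lastP: l hc hx {lrR} => [|l c'] hc hx; first by rewrite infix0s in hx.
  rewrite cats0 -rcons_cat => /rcons_inj[_ ec].
  by rewrite ec mem_rcons inE eqxx in hc.
rewrite -!rcons_cat => /rcons_inj[ex _]; case/negP: hx; apply/infixP.
by exists p, s.
Qed.

Definition joinable R x y := exists z, red R x z /\ red R y z.

(** The left side of [lr2] is placed at position [j] of the left side of [lr1]. If it fits inside,
    the appended part is empty, so inclusions are treated together with proper overlaps. *)
Definition overlap (lr1 lr2 : seq T * seq T) j : seq T :=
  lr1.1 ++ drop (size lr1.1 - j) lr2.1.
Definition overlaps (lr1 lr2 : seq T * seq T) j : bool :=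
  take (size lr2.1) (drop j (overlap lr1 lr2 j)) == lr2.1.
Definition reduct1 (lr1 lr2 : seq T * seq T) j : seq T :=
  lr1.2 ++ drop (size lr1.1 - j) lr2.1.
Definition reduct2 (lr1 lr2 : seq T * seq T) j : seq T :=
  take j lr1.1 ++ lr2.2 ++ drop (j + size lr2.1) (overlap lr1 lr2 j).

Definition critical_pairs_joinable R := forall lr1 lr2 j,
  lr1 \in R -> lr2 \in R -> j < size lr1.1 -> overlaps lr1 lr2 j ->
  joinable R (reduct1 lr1 lr2 j) (reduct2 lr1 lr2 j).

Lemma joinable_cat R p s x y : joinable R x y -> joinable R (p ++ x ++ s) (p ++ y ++ s).
Proof. by move=> [z [h h']]; exists (p ++ z ++ s); split; apply: red_cat. Qed.

Lemma joinable_sym R x y : joinable R x y -> joinable R y x.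
Proof. by move=> [z [h h']]; exists z. Qed.

(** The critical pair lemma: disjoint steps commute, and two steps that meet form a critical pair in
    a context. *)
Lemma local_confluence R w w1 w2 : critical_pairs_joinable R ->
  rstep R w w1 -> rstep R w w2 -> joinable R w1 w2.
Proof.
move=> cp.
suff gen p1 s1 l1 r1 p2 s2 l2 r2 : (l1, r1) \in R -> (l2, r2) \in R ->
    size p1 <= size p2 -> p1 ++ l1 ++ s1 = p2 ++ l2 ++ s2 ->
    joinable R (p1 ++ r1 ++ s1) (p2 ++ r2 ++ s2).
  move=> h1 h2; case: h1 h2 => p1 s1 l1 r1 lr1; move ew: (_ ++ _) => w0 h2.
  case: h2 ew => p2 s2 l2 r2 lr2 ew.
  case: (leqP (size p1) (size p2)) => h; first exact: gen ew.
  by apply: joinable_sym; apply: gen (esym ew) => //; apply: ltnW.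
move=> lr1 lr2 hp e.
have ep : p2 = p1 ++ drop (size p1) p2.
  have := congr1 (take (size p1)) e.
  by rewrite take_size_cat // takel_cat // => e'; rewrite {1}e' cat_take_drop.
move: (drop _ _) ep => t ep {hp}; subst p2.
move/eqP: e; rewrite -!catA eqseq_cat // eqxx /= => /eqP e.
have [ht|ht] := leqP (size l1) (size t).
  have et : t = l1 ++ drop (size l1) t.
    have := congr1 (take (size l1)) e.
    by rewrite take_size_cat // takel_cat // => e'; rewrite {1}e' cat_take_drop.
  move: (drop _ _) et => t' et; subst t.
  move/eqP: e; rewrite -!catA eqseq_cat // eqxx /= => /eqP ->.
  exists (p1 ++ r1 ++ t' ++ r2 ++ s2); split.
    by have := red_rule (p1 ++ r1 ++ t') s2 lr2; rewrite -!catA.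
  exact: (red_rule p1 (t' ++ r2 ++ s2) lr1).
have et : t = take (size t) l1.
  have := congr1 (take (size t)) e.
  by rewrite [RHS]take_size_cat // takel_cat // ltnW.
move: (size t) ht et => j hj et; subst t.
have := e; rewrite -{1}(cat_take_drop j l1) -catA => /eqP.
rewrite eqseq_cat // eqxx /= => /eqP {}e.
have [h|h] := leqP (size l2) (size l1 - j).
  have e2 : drop (size l1 - j) l2 = [::] by rewrite drop_oversize.
  have tl : take (size l2) (drop j l1) = l2.
    have := congr1 (take (size l2)) e.
    by rewrite [RHS]take_size_cat // takel_cat // size_drop.
  have es2 : s2 = drop (j + size l2) l1 ++ s1.
    move/eqP: e; rewrite -{1}(cat_take_drop (size l2) (drop j l1)) tl -catA.
    by rewrite eqseq_cat // eqxx /= drop_drop addnC => /eqP ->.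
  have := cp _ _ j lr1 lr2 hj.
  rewrite /overlaps /reduct1 /reduct2 /overlap /= e2 !cats0 tl eqxx => /(_ isT).
  move=> /(@joinable_cat _ p1 s1); rewrite es2.
  by rewrite -!catA.
have hsz : size (drop j l1) <= size l2 by rewrite size_drop ltnW.
have el2 : l2 = drop j l1 ++ drop (size l1 - j) l2.
  have := congr1 (take (size (drop j l1))) e.
  rewrite take_size_cat // takel_cat // size_drop => {1}->.
  by rewrite cat_take_drop.
have es1 : s1 = drop (size l1 - j) l2 ++ s2.
  by move/eqP: e; rewrite {1}el2 -catA eqseq_cat // eqxx /= => /eqP.
have := cp _ _ j lr1 lr2 hj.
rewrite /overlaps /reduct1 /reduct2 /overlap /= drop_cat hj -el2 take_size eqxx => /(_ isT).
have -> : drop (j + size l2) (l1 ++ drop (size l1 - j) l2) = [::].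
  by apply: drop_oversize; rewrite size_cat size_drop; lia.
move=> /(@joinable_cat _ p1 s2); rewrite cats0 es1.
by rewrite -!catA.
Qed.

(** * Normal forms of complete rewriting systems *)

Section NormalForms.
Variable R : seq (seq T * seq T).
Hypothesis wfR : well_founded (fun y x => rstep R x y).
Hypothesis cpR : critical_pairs_joinable R.

Lemma reducible_step w : ~~ irreducible R w -> exists w', rstep R w w'.
Proof.
rewrite negbK => /hasP[[l r] lr /infixP[p [s ->]]].
by exists (p ++ r ++ s); apply: RStep.
Qed.

Lemma irreducible_no_step w w' : irreducible R w -> ~ rstep R w w'.
Proof.
move=> /hasPn h st; case: st h => p s l r lr /(_ _ lr) /negP; apply.
by apply/infixP; exists p, s.
Qed.

Lemma exists_nf w : exists n, red R w n /\ irreducible R n.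
Proof.
elim: (wfR w) => {}w _ IH.
have [h|/reducible_step[w' st]] := boolP (irreducible R w).
  by exists w; split=> //; apply: rt_refl.
have [n [h hn]] := IH _ st; exists n; split=> //.
exact: rt_trans (rt_step _ _ _ _ st) h.
Qed.

Lemma red_irreducible w n : irreducible R w -> red R w n -> w = n.
Proof.
move=> hw /(@clos_rt_rt1n _ _ _ _) h; case: h hw => // y z st _ hw.
by have := irreducible_no_step hw st.
Qed.

(** Newman's lemma by well-founded induction: join the two first steps, then reduce the common word
    to an irreducible one. *)
Lemma nf_unique w n1 n2 : red R w n1 -> irreducible R n1 -> red R w n2 ->
  irreducible R n2 -> n1 = n2.
Proof.
elim: (wfR w) n1 n2 => {}w _ IH n1 n2 h1 i1 h2 i2.
case: (clos_rt_rt1n _ _ _ _ h1) i1 => [i1|w1 n1' st1 /(@clos_rt1n_rt _ _ _ _) h1' i1].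
  exact: red_irreducible.
case: (clos_rt_rt1n _ _ _ _ h2) i2 => [i2|w2 n2' st2 /(@clos_rt1n_rt _ _ _ _) h2' i2].
  by have := irreducible_no_step i2 st1.
have [z [z1 z2]] := local_confluence cpR st1 st2.
have [n [zn hn]] := exists_nf z.
rewrite (IH _ st1 n1' n h1' i1 (rt_trans _ _ _ _ _ z1 zn) hn).
by rewrite (IH _ st2 n2' n h2' i2 (rt_trans _ _ _ _ _ z2 zn) hn).
Qed.

Lemma conv_nf w w' : clos_refl_sym_trans _ (red R) w w' ->
  forall n, irreducible R n -> red R w n <-> red R w' n.
Proof.
elim=> [x y xy|x|x y _ IH|x y z _ IH _ IH'] n hn //.
- split=> [xn|yn]; last exact: rt_trans xy yn.
  have [n' [yn' hn']] := exists_nf y.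
  by rewrite (nf_unique xn hn (rt_trans _ _ _ _ _ xy yn') hn').
- by rewrite IH.
- by rewrite IH // IH'.
Qed.

Lemma conv_irreducible w w' : clos_refl_sym_trans _ (red R) w w' ->
  irreducible R w -> irreducible R w' -> w = w'.
Proof.
move=> c hw hw'; have /(conv_nf c hw) := rt_refl _ (rstep R) w.
by move=> /(red_irreducible hw').
Qed.

End NormalForms.

Lemma wf_rstep R (f g : seq T -> nat) :
  (forall x y, rstep R x y -> f y < f x \/ f y = f x /\ g y < g x) ->
  well_founded (fun y x => rstep R x y).
Proof.
move=> H w; have [n] := ubnP (f w); elim: n w => [w|n IHn w hn]; first by rewrite ltn0.
have [m] := ubnP (g w); elim: m w hn => [w _|m IHm w hn hm]; first by rewrite ltn0.
constructor=> y /H [lt|[e lt]]; first by apply: IHn; lia.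
by apply: IHm; lia.
Qed.

Fixpoint rewrite_head R w : option (seq T) :=
  if R is (l, r) :: R' then
    if prefix l w then Some (r ++ drop (size l) w) else rewrite_head R' w
  else None.

Fixpoint rewrite_once R w : option (seq T) :=
  if rewrite_head R w is Some w' then Some w'
  else if w is a :: w' then omap (cons a) (rewrite_once R w') else None.

(** The fuel may run out; only reachability of the result is claimed, and irreducibility is tested
    where it is needed. *)
Fixpoint normalize n R w : seq T :=
  if n is n'.+1 then
    if rewrite_once R w is Some w' then normalize n' R w' else w
  else w.

Lemma rewrite_head_red R w w' : rewrite_head R w = Some w' -> red R w w'.
Proof.
suff gen R' : {subset R' <= R} -> rewrite_head R' w = Some w' -> red R w w'.
  exact: gen.
elim: R' => //= [[l r] R' IH] sub; case: prefixP => [[s ->] [<-]|_].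
  rewrite drop_size_cat //; have := @red_rule R [::] s l r.
  by apply; apply: sub; rewrite inE eqxx.
by apply: IH => lr h; apply: sub; rewrite inE h orbT.
Qed.

Lemma rewrite_once_red R w w' : rewrite_once R w = Some w' -> red R w w'.
Proof.
elim: w w' => [|a w IH] w' /=.
  by case e: (rewrite_head R [::]) => [v|] // [<-]; apply: rewrite_head_red.
case e: (rewrite_head R (a :: w)) => [v|]; first by move=> [<-]; apply: rewrite_head_red.
case e': (rewrite_once R w) => [v|] //= [<-].
by have := red_cat [:: a] [::] (IH _ e'); rewrite !cats0.
Qed.

Lemma normalize_red n R w : red R w (normalize n R w).
Proof.
elim: n w => [|n IH] w /=; first exact: rt_refl.
case e: (rewrite_once R w) => [w'|]; last exact: rt_refl.
exact: rt_trans (rewrite_once_red e) (IH w').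
Qed.

End Rewriting.

(** * Transport of rules along a renaming of letters *)

Section MapRules.
Variables (T T' : eqType) (h : T -> T') (P : pred T).
Hypothesis injh : {in P &, injective h}.

Definition map_rules (R : seq (seq T * seq T)) :=
  map (fun lr => (map h lr.1, map h lr.2)) R.

Lemma red_map R x y : red R x y -> red (map_rules R) (map h x) (map h y).
Proof.
elim=> [x' y' [p s l r lr]|x'|x' y' z _ r1 _ r2].
- rewrite !map_cat; apply: red_rule.
  by apply/mapP; exists (l, r).
- exact: rt_refl.
- exact: rt_trans r1 r2.
Qed.

Lemma inj_map_all (x y : seq T) : all P x -> all P y -> map h x = map h y -> x = y.
Proof.
elim: x y => [|a x IH] [|b y] //= /andP[pa px] /andP[pb py] [e /(IH _ px py) ->].
by rewrite (injh pa pb e).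
Qed.

Lemma irreducible_map R w : all P w ->
  all (fun lr => all P lr.1) R -> irreducible (map_rules R) (map h w) = irreducible R w.
Proof.
move=> pw /allP pR; congr negb; rewrite has_map; apply: eq_in_has => lr /pR pl /=.
apply/occursP/occursP => -[i [hi e]]; exists i; move: hi e; rewrite !size_map => hi.
  rewrite -map_drop -map_take => e; split=> //; apply: inj_map_all e => //.
  by apply/allP => c /mem_take /mem_drop; apply/allP.
by move=> e; split=> //; rewrite -map_drop -map_take e.
Qed.

Lemma critical_pairs_map R : all (fun lr => all P lr.1) R ->
  critical_pairs_joinable R -> critical_pairs_joinable (map_rules R).
Proof.
move=> /allP pR cp _ _ j /mapP[lr1 h1 ->] /mapP[lr2 h2 ->].
rewrite /= size_map => hj; rewrite /overlaps /overlap /reduct1 /reduct2 /= /overlap /= !size_map.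
rewrite -!map_drop -!map_cat -!map_drop -!map_take -!map_cat => /eqP e.
have {}e : overlaps lr1 lr2 j.
  apply/eqP; apply: inj_map_all e; last exact: pR.
  apply/allP => c /mem_take /mem_drop; rewrite mem_cat => /orP[|/mem_drop];
    by apply/allP; apply: pR.
have [z [z1 z2]] := cp _ _ _ h1 h2 hj e.
by exists (map h z); split; apply: red_map.
Qed.

End MapRules.

(** The automaton remembers the last q letters, or that a left side has occurred; no left side has
    more than q+1 letters. *)
Lemma regular_irreducible (C : finType) (R : seq (seq C * seq C)) :
  regular (fun w => irreducible R w).
Proof.
have [q hR] : exists q, all (fun lr => size lr.1 <= q.+1) R.
  exists (\max_(lr <- R) size lr.1); apply/allP => lr lrR; apply: leqW.
  exact: leq_bigmax_seq.
pose suf (w : seq C) : {bseq q of C} := insub_bseq q (drop (size w - q) w).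
have sufE w : suf w = drop (size w - q) w :> seq C.
  by rewrite /suf /insub_bseq insubdK // -topredE /= size_drop; lia.
pose d (s : option {bseq q of C}) c := if s is Some v then
  if irreducible R (rcons v c) then Some (suf (rcons v c)) else None else None.
apply: (@regular_finType _ (option {bseq q of C})
  (if irreducible R [::] then Some (suf [::]) else None) d isSome) => w.
suff -> : foldl d (if irreducible R [::] then Some (suf [::]) else None) w =
  if irreducible R w then Some (suf w) else None by case: irreducible.
elim/last_ind: w => [//|w c IH]; rewrite foldl_rcons IH.
have [hw|hw] := boolP (irreducible R w) => /=; last first.
  case: ifP => // h; case/negP: hw; move: h; rewrite -cats1; exact: irreducible_catl.
rewrite sufE.
have -> : irreducible R (rcons (drop (size w - q) w) c) = irreducible R (rcons w c).
  have [hq|hq] := leqP (size w) q.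
    by rewrite (_ : size w - q = 0) ?drop0 //; lia.
  apply/idP/idP => h; last first.
    apply: irreducible_infix h; apply/infixP; exists (take (size w - q) w), [::].
    by rewrite cats0 -!cats1 catA cat_take_drop.
  rewrite -cats1 -(cat_take_drop (size w - q) w) -catA; apply: (irreducible_glue hR).
  - by rewrite cat_take_drop.
  - by rewrite cats1.
  - by rewrite size_drop subKn // ltnW.
case: ifP => // _; congr Some; apply: val_inj => /=; rewrite !sufE.
rewrite !size_rcons size_drop -drop_rcons ?leq_subr // drop_drop; congr drop.
by move: (size w) => m; lia.
Qed.

(** * Certified carries *)

Definition rules := seq (seq nat * seq nat).
Definition nf (R : rules) (w : seq nat) := normalize 60 R w.

(* Multiplying an irreducible word al by a letter x on the right: a state
   (p, d, o, r) describes a suffix al2 of al with first q letters p such that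
   al2 x = d out is irreducible; o tells whether out may be nonempty and r is
   the offset recorded by [chain]. Only the first K letters are kept in d. *)
Definition state := (seq nat * seq nat * bool * option nat)%type.

Section Checker.
Variables (K B q : nat) (R : rules) (nl : nat).

(** If output may exist, the new word must end in the same q letters as [d]: left sides have at most
    q+1 letters, so the boundary with the output stays irreducible. An absent offset starts at [B],
    the middle of its range, when output appears. *)
Definition carry_next (s : state) (a : nat) : option state :=
  let: (p, d, o, r) := s in
  let w := nf R (a :: d) in
  let o' := o || (K < size w) in
  if [&& irreducible R w, size w <= (2 * K).+1,
         o ==> (q <= size w) && (drop (size w - q) w == drop (size d - q) d)
       & if r is Some m then
           (size w <= m + 1 + size d) && (m + 1 + size d - size w <= 2 * B)
         else true]
  then Some (take q (a :: p), take K w, o',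
             if r is Some m then Some (m + 1 + size d - size w)
             else if o' then Some B else None)
  else None.

(* Once al2 and d start with the same q letters, no further rewriting occurs. *)
Definition synchronized (s : state) : bool :=
  let: (p, d, _, _) := s in (size p == q) && (take q d == p).

Definition successors (s : state) : seq (option state) :=
  if synchronized s then [::] else
  [seq carry_next s a | a <- iota 0 nl & irreducible R (a :: s.1.1.1)].

(** The search is not trusted: failure is reported by the empty list, and [closed_states] checks the
    resulting states independently. *)
Fixpoint explore (fuel : nat) (todo seen : seq state) : seq state :=
  if fuel is n.+1 then
    if todo is s :: todo' then
      if s \in seen then explore n todo' seen
      else let next_states := successors s in
        if all isSome next_states then explore n (pmap id next_states ++ todo') (s :: seen)
        else [::]
    else seen
  else seen.

Definition closed_states (V : seq state) : bool :=
  all (fun s => all (fun s' => if s' is Some s1 then s1 \in V else false)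
                    (successors s)) V.

Definition initial (bi : bool) (x : nat) : state :=
  ([::], [:: x], false, if bi then Some B else None).

Definition carries_ok (bi : bool) : bool :=
  [&& all (fun lr => size lr.1 <= q.+1) R, q <= K, 0 < K &
   all (fun x => irreducible R [:: x] ==>
     let V := explore 3000 [:: initial bi x] [::] in
     (initial bi x \in V) && closed_states V) (iota 0 nl)].

End Checker.

Section CarrySound.
Variables (C : finType) (E : seq C -> seq C -> Prop).
Hypothesis congE : congruence E.
Variables (K B q nl : nat) (R : rules) (h : nat -> C).
Let P : pred nat := fun i => i < nl.
Hypothesis injh : {in P &, injective h}.
Hypothesis lettersR : all (fun lr => all P lr.1 && all P lr.2) R.
Hypothesis soundR : forall lr, lr \in R -> E (map h lr.1) (map h lr.2).
Variable bi : bool.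
Hypothesis okR : carries_ok K B q R nl bi.

Let RC := map_rules h R.
Let start : option nat := if bi then Some B else None.

Let PR : all (fun lr => all P lr.1) R.
Proof. by apply: sub_all lettersR => lr /andP[]. Qed.

Let sizeRC : all (fun lr => size lr.1 <= q.+1) RC.
Proof.
case/and4P: okR => hq _ _ _; rewrite all_map; apply: sub_all hq => lr /=.
by rewrite size_map.
Qed.

Lemma red_letters x y : all P x -> red R x y -> all P y.
Proof.
move=> px r; elim: r px => // [x' y' [p s l r lr]|x' y' z _ IH _ IH'].
  rewrite !all_cat => /and3P[-> _ ->]; rewrite andbT /=.
  by have /andP[] := allP lettersR _ lr.
by move=> /IH.
Qed.

Lemma red_sound x y : red R x y -> E (map h x) (map h y).
Proof.
case: congE => rf _ tr cg; elim=> [x' y' [p s l r lr]|x'|x' y' z _ IH _ IH'].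
- by rewrite !map_cat; apply: cg; apply: (soundR lr).
- exact: rf.
- exact: tr IH IH'.
Qed.

(** Where nothing is rewritten, the letter and the whole carry are sent to the output, which leaves
    an existing offset unchanged. *)
Lemma chain_id x g al d out r : size x <= K -> chain E K B x start al d out r ->
  exists d' out' r', chain E K B x start (g ++ al) d' out' r' /\
    d' ++ out' = g ++ d ++ out.
Proof.
move=> hx ch; elim: g => [|a g [d' [out' [r' [ch' e]]]]]; first by exists d, out, r.
have hs : offset_bounded B start by rewrite /start; case: bi => //=; lia.
have [hd hr _] := chain_bounds hx hs ch'.
exists [::], ((a :: d') ++ out'), (if r' is Some m then Some m else Some B).
split; last by rewrite /= e.
apply: (ChainS ch') => //=; first by case: congE.
by case: r' hr {ch'} => [m|] //= hm; split=> //; lia.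
Qed.

Section Letter.
Variables (x : nat) (V : seq state).
Hypothesis Vx : initial B bi x \in V.
Hypothesis Vcl : closed_states K B q R nl V.

(** What a state knows about the forgotten output: it is empty unless the flag is set, and with the
    flag set the carry has at least q letters, so that a left side beginning at a new letter cannot
    reach the output. *)
Let live (al : seq nat) (s : state) : Prop := exists out,
  let: (p, d, o, r) := s in
  [/\ chain E K B [:: h x] start (map h al) (map h d) (map h out) r,
      irreducible R (d ++ out) /\ all P (d ++ out), p = take q al,
      ~~ o -> out = [::] & o -> q <= size d].

Lemma live_step a al s : P a -> all P al -> irreducible R (a :: al) -> s \in V ->
  live al s -> ~~ synchronized q s -> exists s', s' \in V /\ live (a :: al) s'.
Proof.
move=> Pa Pal ia sV; case: s sV => [[[p d] o] r] sV.
case=> out [ch [iout Pout] ep ho hd] ns.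
have ip : irreducible R (a :: p).
  apply: irreducible_catl (_ : irreducible R ((a :: p) ++ drop q al)).
  by rewrite ep /= cat_take_drop.
have: carry_next K B q R (p, d, o, r) a \in successors K B q R nl (p, d, o, r).
  rewrite /successors (negbTE ns); apply/mapP; exists a => //.
  by rewrite mem_filter ip mem_iota /= add0n.
have /allP Vs := allP Vcl _ sV; move=> /Vs; rewrite /carry_next.
move: (nf R (a :: d)) (normalize_red 60 R (a :: d) : red R _ (nf R (a :: d))) => w rw.
case: ifP => // /and4P[iw szw how hr] sV'; eexists; split; first exact: sV'.
exists (drop K w ++ out).
have Pw : all P w.
  by apply: red_letters rw; move: Pout; rewrite /= all_cat Pa => /andP[->].
have cdw : take K w ++ drop K w = w by rewrite cat_take_drop.
case/and4P: okR => hq qK _ _.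
split.
- rewrite map_cat; apply: (ChainS ch).
  + by rewrite -map_cat cdw; apply: red_sound rw.
  + by rewrite size_map size_take_min geq_minl.
  + by rewrite size_map size_drop leq_subLR addnS addnn -mul2n.
  + have sw : size (map h (take K w)) + size (map h (drop K w)) = size w.
      by rewrite !size_map -size_cat cdw.
    case: r hr {Vs ch sV sV' ns} => [m|].
      by move=> /andP[h1 h2]; split=> //; rewrite -addnA sw size_map subnK.
    move=> _; case: ifP; first by split=> //; rewrite mul2n -addnn leq_addl.
    move=> /negbT; rewrite negb_or -leqNgt => /andP[_ hK]; split=> //.
    by rewrite drop_oversize.
- rewrite catA cdw; split; last first.
    by move: Pout; rewrite !all_cat Pw => /andP[_ ->].
  case eo: o ho how => [|] ho; last by rewrite (ho isT) cats0.
  move=> /andP[qw /eqP ew].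
  rewrite -(cat_take_drop (size w - q) w) -catA; apply: (irreducible_glue hq).
  + by rewrite cat_take_drop.
  + rewrite ew; apply: irreducible_catr (_ : irreducible R (take (size d - q) d ++ _)).
    by rewrite catA cat_take_drop.
  + by rewrite size_drop subKn.
- by rewrite ep; case: q => //= n; rewrite -take_min (minn_idPl _).
- by rewrite negb_or -leqNgt => /andP[/ho -> hK]; rewrite cats0 drop_oversize.
- rewrite size_take; case: ifP => // hK; rewrite orbF => eo.
  by move: how; rewrite eo => /andP[].
Qed.

Hypothesis Px : P x.
Hypothesis irrx : irreducible R [:: x].

Lemma live_or_synchronized al : all P al -> irreducible R al ->
  exists al1 al2 s, [/\ al = al1 ++ al2, s \in V, live al2 s &
    al1 = [::] \/ synchronized q s].
Proof.
elim: al => [_ i0|a al IH /= /andP[Pa Pal] ia].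
  exists [::], [::], (initial B bi x); split=> //; last by left.
  exists [::]; split=> //=; [exact: Chain0 | by rewrite Px].
have ial : irreducible R al by apply: (@irreducible_catr _ _ [:: a]).
have [al1 [al2 [s [eal sV ls]]]] := IH Pal ial.
have [sy|ns] := boolP (synchronized q s) => h1.
  by exists (a :: al1), al2, s; split=> //; [rewrite eal | right].
have {h1} e1 : al1 = [::] by case: h1 => // h1; rewrite h1 in ns.
move: eal; rewrite e1 => eal; subst al.
have [s' [sV' ls']] := live_step Pa Pal ia sV ls ns.
by exists [::], (a :: al2), s'; split=> //; left.
Qed.

Lemma chain_letter al : irreducible RC al ->
  exists d out r, chain E K B [:: h x] start al d out r /\ irreducible RC (d ++ out).
Proof.
move=> ial; case/and4P: okR => hq qK K0 _.
(* [al0] is the longest suffix over the letters of the certificate; the letter before it, if any,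
   occurs in no rule and stops all rewriting. *)
have [g [al0 [eal Pal0 hg]]] : exists g al0, [/\ al = g ++ map h al0, all P al0 &
    g = [::] \/ exists g' c, g = rcons g' c /\ forall i, P i -> c <> h i].
  elim/last_ind: al {ial} => [|al c [g [al0 [-> Pal0 hg]]]].
    by exists [::], [::]; split=> //; left.
  case: (boolP (c \in map h (iota 0 nl))) => hc.
    case/mapP: hc => i; rewrite mem_iota add0n => /= Pi ->.
    exists g, (rcons al0 i); rewrite map_rcons rcons_cat; split=> //.
    by rewrite all_rcons Pal0 andbT.
  exists (rcons (g ++ map h al0) c), [::]; rewrite cats0; split=> //; right.
  exists (g ++ map h al0), c; split=> // i Pi ec; case/negP: hc.
  by rewrite ec; apply: map_f; rewrite mem_iota add0n.
have ial0 : irreducible R al0.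
  by rewrite -(irreducible_map injh Pal0 PR); apply: irreducible_catr (_ : irreducible _ (g ++ _));
    rewrite -eal.
have [al1 [al2 [[[[p d] o] r] [e0 sV [out [ch [iout Pout] ep ho hd]] hs]]]] :=
  live_or_synchronized Pal0 ial0.
have ioutC : irreducible RC (map h d ++ map h out).
  by rewrite -map_cat (irreducible_map injh).
have [d' [out' [r' [ch' e']]]] := @chain_id [:: h x] (g ++ map h al1) _ _ _ _ K0 ch.
exists d', out', r'; split; first by rewrite eal e0 map_cat catA.
rewrite e'; case: hs => [e1|/andP[/eqP sp /eqP sd]].
  rewrite e1 cats0; case: hg => [-> //|[g' [c [eg hc]]]]; rewrite eg.
  apply: irreducible_sep => //; last first.
    by apply: irreducible_catl (_ : irreducible _ (_ ++ map h al0)); rewrite -eg -eal.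
  apply/allP => _ /mapP[lr lrR ->] /=; apply/mapP => -[i il ec].
  by apply: (hc i) => //; have /allP := allP PR _ lrR; apply.
have ip : irreducible RC ((g ++ map h al1) ++ map h p).
  apply: (@irreducible_catl _ _ _ (map h (drop q al2))).
  by rewrite -!catA -map_cat ep cat_take_drop -map_cat -e0 -eal.
have ed : map h d ++ map h out = map h p ++ map h (drop q d) ++ map h out.
  by rewrite -sd [RHS]catA -(map_cat h (take q d)) cat_take_drop.
rewrite ed; apply: (irreducible_glue sizeRC) => //; first by rewrite -ed.
by rewrite size_map sp.
Qed.

End Letter.

Lemma chain_other x al : irreducible RC al ->
  (if x is Some c then forall i, P i -> c <> h i else True) ->
  exists d out r, chain E K B (oseq x) start al d out r /\ irreducible RC (d ++ out).
Proof.
move=> ial hx; case/and4P: okR => hq qK K0 _.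
have hs : size (oseq x) <= K by case: (x).
have [d [out [r [ch e]]]] := chain_id al hs (Chain0 E K B (oseq x) start).
rewrite cats0 in ch; exists d, out, r; split=> //; rewrite e cats0.
case: x hx {ch hs e} => [c|] hc /=; last by rewrite cats0.
rewrite cats1; apply: irreducible_rcons => //.
apply/allP => _ /mapP[lr lrR ->] /=; apply/mapP => -[i il ec].
by apply: (hc i) => //; have /allP := allP PR _ lrR; apply.
Qed.

Lemma chain_exists x al : irreducible RC al ->
  irreducible RC (oseq x) ->
  exists d out r, chain E K B (oseq x) start al d out r /\ irreducible RC (d ++ out).
Proof.
case: x => [c|] ial ic; last exact: chain_other.
case: (boolP (c \in map h (iota 0 nl))) => [/mapP[i]|hc]; last first.
  apply: chain_other => // i Pi ec; case/negP: hc.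
  by rewrite ec; apply: map_f; rewrite mem_iota add0n.
rewrite mem_iota add0n => /= Pi ec.
have ii : irreducible R [:: i].
  by have := ic; rewrite /= ec -[[:: h i]]/(map h [:: i]) (irreducible_map injh) //= andbT.
case/and4P: okR => _ _ _ /allP /(_ i); rewrite mem_iota add0n => /(_ Pi) /implyP /(_ ii).
by move=> /andP[Vi Vcl]; rewrite ec; apply: (chain_letter Vi Vcl).
Qed.

End CarrySound.

(** * The language of irreducible words *)

Section Language.
Variables (C : finType) (m : nat) (e : 'I_m) (h : 'I_m -> option C).
Hypothesis he : forall b, (h b == None) = (b == e).
Implicit Types (s t w : seq 'I_m) (R : seq (seq C * seq C)).

Definition letter_val b : seq C := oseq (h b).
Local Notation lvals := (vals letter_val).

(* The empty word, which L must avoid, is replaced by the letter e. *)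
Definition well_formed w : bool := (w == [:: e]) || (w != [::]) && (e \notin w).
Definition irr_lang R w : bool := well_formed w && irreducible R (lvals w).

Lemma valsE w : lvals w = pmap h w.
Proof. by elim: w => //= b w; rewrite /vals /= /letter_val => ->; case: (h b). Qed.

Lemma regular_irr_lang R : regular (fun w => irr_lang R w).
Proof.
have r1 := regular_preim_pmap h (regular_irreducible R).
have r2 : regular (fun w => well_formed w).
  pose d (q : bool * bool) (b : 'I_m) := match q with
    | (false, false) => if b == e then (true, true) else (true, false)
    | (true, false) => if b == e then (false, true) else (true, false)
    | _ => (false, true) end.
  apply: (@regular_finType _ (bool * bool)%type (false, false) d (fun q => q.1)) => w.
  have dead v : foldl d (false, true) v = (false, true) by elim: v.
  have plain v : (foldl d (true, false) v).1 = (e \notin v).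
    elim: v => //= b v IH; rewrite inE eq_sym; case: eqP => _ //=.
    by rewrite dead.
  have -> : (foldl d (false, false) w).1 = well_formed w; last by [].
  case: w => //= b w; rewrite /well_formed /= eqseq_cons inE negb_or eq_sym.
  have [_|_] := eqVneq e b; rewrite /= ?plain //.
  by rewrite orbF; case: w => //= c w; rewrite dead.
apply: eq_regular (regularI r2 r1) => w; rewrite /irr_lang valsE.
by split=> [[-> ->]|/andP].
Qed.

Lemma letter_val1 b : b != e -> exists c, letter_val b = [:: c].
Proof. by rewrite -he /letter_val; case: (h b) => // c _; exists c. Qed.

Lemma vals_cons b w : lvals (b :: w) = letter_val b ++ lvals w.
Proof. by []. Qed.

Lemma vals_rev w : lvals (rev w) = rev (lvals w).
Proof.
elim: w => //= b w IH; rewrite rev_cons -cats1 vals_cons rev_cat -IH.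
rewrite /vals map_cat flatten_cat /= cats0 /letter_val.
by case: (h b).
Qed.

Lemma cols_plain s t : e \notin s -> e \notin t ->
  map (colval letter_val) (padR s t) = cols (lvals s) (lvals t).
Proof.
elim: s t => [|a s IH]; elim=> [|b t IHt] //; rewrite ?in_cons ?negb_or.
- move=> h1 /andP[hb h2]; rewrite padRE /= vals_cons.
  have [c eb] : exists c, letter_val b = [:: c] by apply: letter_val1; rewrite eq_sym.
  by rewrite /colval /= eb cols_consr IHt.
- move=> /andP[ha h1] h2; rewrite padRE /= vals_cons.
  have [c eb] : exists c, letter_val a = [:: c] by apply: letter_val1; rewrite eq_sym.
  by rewrite {1}/colval /= eb cols_consl IH.
- move=> /andP[ha h1] /andP[hb h2]; rewrite padRE /= !vals_cons.
  have [c eb] : exists c, letter_val a = [:: c] by apply: letter_val1; rewrite eq_sym.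
  have [c' eb'] : exists c, letter_val b = [:: c] by apply: letter_val1; rewrite eq_sym.
  by rewrite {1}/colval /= eb eb' cols_cons IH.
Qed.

Lemma vals_e : lvals [:: e] = [::].
Proof. by rewrite /vals /= /letter_val; have := he e; rewrite eqxx => /eqP ->. Qed.

(** The letter [e] paired with itself is exceptional: it gives one column with two empty values,
    whereas two empty words have no column. *)
Lemma cols_well_formed s t : well_formed s -> well_formed t ->
  (s = [:: e] /\ t = [:: e]) \/
  map (colval letter_val) (padR s t) = cols (lvals s) (lvals t).
Proof.
have ve : letter_val e = [::] by rewrite -vals_e /vals /= cats0.
move=> /orP[/eqP->|/andP[s0 hs]] /orP[/eqP->|/andP[t0 ht]]; first by left.
- right; rewrite vals_e; case: t t0 ht => // b t _; rewrite in_cons negb_or => /andP[hb ht].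
  have [c eb] : exists c, letter_val b = [:: c] by apply: letter_val1; rewrite eq_sym.
  rewrite padRE /= vals_cons eb cols_consr {1}/colval /= ve eb.
  by rewrite cols_plain.
- right; rewrite vals_e; case: s s0 hs => // b s _; rewrite in_cons negb_or => /andP[hb hs].
  have [c eb] : exists c, letter_val b = [:: c] by apply: letter_val1; rewrite eq_sym.
  rewrite padRE /= vals_cons eb cols_consl {1}/colval /= ve eb.
  by rewrite cols_plain.
- by right; apply: cols_plain.
Qed.

Lemma well_formed_rev w : well_formed (rev w) = well_formed w.
Proof.
rewrite /well_formed mem_rev; congr (_ || _ && _).
  by rewrite -{1}[[:: e]]revK (inj_eq (can_inj (@revK _))).
by rewrite -!size_eq0 size_rev.
Qed.

Variables (E : seq C -> seq C -> Prop) (R : seq (seq C * seq C)).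
Hypothesis congE : congruence E.
Hypothesis uniqE : forall x y, E x y -> irreducible R x -> irreducible R y -> x = y.
Hypothesis irrh : forall b, irreducible R (letter_val b).
Variables (K B : nat) (bi : bool).
Let start : option nat := if bi then Some B else None.
Hypothesis K0 : 0 < K.
Hypothesis chainE : forall x al, irreducible R al ->
  irreducible R (oseq x) ->
  exists d out r, chain E K B (oseq x) start al d out r /\ irreducible R (d ++ out).

Let L w : Prop := irr_lang R w.

(** The chain ends in an irreducible word equal to the product, which uniqueness identifies with the
    value of [t]. *)
Lemma run_lang (a : option 'I_m) s t :
  L s -> L t -> E (lvals s ++ oval letter_val a) (lvals t) ->
  exists r d out, [/\ chain E K B (oval letter_val a) start (lvals s) d out r,
    lvals t = d ++ out & size (oval letter_val a) <= K].
Proof.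
move=> /andP[_ is_] /andP[_ it] est.
have ex : oval letter_val a = oseq (obind h a) by case: (a).
have ic : irreducible R (oseq (obind h a)).
  case: (a) => [b|] /=; first exact: irrh.
  exact: (@irreducible_catl _ R [::] (lvals s)).
have [d [out [r [ch io]]]] := chainE is_ ic.
exists r, d, out; rewrite ex; split=> //; last by case: obind.
apply: uniqE => //; case: congE => _ sy tr _; apply: tr (sy _ _ est) _.
by rewrite ex; apply: chain_sound ch.
Qed.

Lemma start_bounded : offset_bounded B start.
Proof. by rewrite /start; case: bi => //=; lia. Qed.

Lemma run_trivial M (a : option 'I_m) :
  E (lvals [:: e] ++ oval letter_val a) (lvals [:: e]) ->
  exists c, size c <= M /\
    carry_run E M (oval letter_val a) c c [:: ([::], [::])].
Proof.
rewrite vals_e => /= ea; exists [::]; split=> //.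
have -> : oval letter_val a = [::].
  have i0 : irreducible R [::] by have := irrh e; rewrite -vals_e /vals /= cats0.
  by apply: (uniqE ea) => //; case: (a) => [b|]; [exact: (irrh b) | exact: i0].
by exists [::], [::], [::]; split=> //; case: congE.
Qed.

Lemma regular_right_padR (a : option 'I_m) : regular (fun w : seq (option 'I_m * option 'I_m) => exists s t,
  [/\ L s, L t, E (lvals s ++ oval letter_val a) (lvals t) & w = padR s t]).
Proof.
apply: (@regular_right_pad _ _ congE _ _ (@padR _) _ (4 * K + 4 * B + 4)) => //.
- exact: padR_proj.
- by apply: regular_padR; apply: regular_irr_lang.
move=> s t Ls Lt est; have [r [d [out [ch et hx]]]] := run_lang Ls Lt est.
have [[es et']|->] := cols_well_formed (proj1 (andP Ls)) (proj1 (andP Lt)).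
  rewrite es et' in est *; have ve : letter_val e = [::] by rewrite -vals_e /vals /= cats0.
  by rewrite padRE /= /colval /= ve; apply: run_trivial.
rewrite et; exact: (carry_run_padR congE hx start_bounded ch).
Qed.

Lemma regular_right_padL (a : option 'I_m) : bi -> regular (fun w : seq (option 'I_m * option 'I_m) => exists s t,
  [/\ L s, L t, E (lvals s ++ oval letter_val a) (lvals t) & w = padL s t]).
Proof.
move=> hbi.
apply: (@regular_right_pad _ _ congE _ _ (@padL _) _ (4 * K + 4 * B + 4)) => //.
- exact: padL_proj.
- by apply: regular_padL; apply: regular_irr_lang.
move=> s t Ls Lt est; have [r [d [out [ch et hx]]]] := run_lang Ls Lt est.
have := @cols_well_formed (rev s) (rev t); rewrite !well_formed_rev.
move=> /(_ (proj1 (andP Ls)) (proj1 (andP Lt))) [[es et']|ecols].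
  have {}es : s = [:: e] by rewrite -[s]revK es.
  have {}et' : t = [:: e] by rewrite -[t]revK et'.
  rewrite es et' in est *; have ve : letter_val e = [::] by rewrite -vals_e /vals /= cats0.
  by rewrite (_ : padL _ _ = [:: (Some e, Some e)]) //= /colval /= ve; apply: run_trivial.
have -> : map (colval letter_val) (padL s t) =
    map (colval (fun c => [:: c])) (padL (lvals s) (lvals t)).
  by rewrite /padL !map_rev ecols !vals_rev.
by rewrite et; apply: (carry_run_padL congE hx start_bounded _ ch); rewrite /start hbi.
Qed.

End Language.

(** * Certificates *)

Lemma pres_cong_congruence (A : Type) (u v : seq A) : congruence (pres_cong u v).
Proof.
split=> [x|x y|x y z|p s x y]; [exact: rst_refl|exact: rst_sym|exact: rst_trans|].
elim=> [x' y' [p' s']|x'|x' y' _|x' y' z _ h _ h'].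
- have e t : p ++ (p' ++ t ++ s') ++ s = (p ++ p') ++ t ++ (s' ++ s) by rewrite -!catA.
  by rewrite !e; apply: rst_step; apply: RelStep.
- exact: rst_refl.
- exact: rst_sym.
- exact: rst_trans h h'.
Qed.

Lemma pres_cong_map (A A' : Type) (f : A -> A') (u v x y : seq A) :
  pres_cong u v x y -> pres_cong (map f u) (map f v) (map f x) (map f y).
Proof.
elim=> [x' y' [p' s']|x'|x' y' _|x' y' z _ h _ h'].
- by rewrite !map_cat; apply: rst_step; apply: RelStep.
- exact: rst_refl.
- exact: rst_sym.
- exact: rst_trans h h'.
Qed.

Definition neighbours (u v w : seq nat) : seq (seq nat) :=
  [seq take i w ++ v ++ drop (i + size u) w
     | i <- iota 0 (size w).+1 & take (size u) (drop i w) == u].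

Fixpoint convertible (n : nat) (u v x y : seq nat) : bool :=
  (x == y) || (if n is n'.+1 then
    has (fun z => convertible n' u v z y) (neighbours u v x ++ neighbours v u x)
  else false).

Lemma neighbours_step u v w z : z \in neighbours u v w -> rel_step u v w z.
Proof.
move=> /mapP[i]; rewrite mem_filter => /andP[/eqP e _ ->].
rewrite -{1}(cat_take_drop i w) -{1}(cat_take_drop (size u) (drop i w)) e drop_drop addnC.
exact: RelStep.
Qed.

Lemma convertible_sound n u v x y : convertible n u v x y -> pres_cong u v x y.
Proof.
elim: n x => [|n IH] x /=; first by rewrite orbF => /eqP ->; apply: rst_refl.
move=> /orP[/eqP ->|/hasP[z]]; first exact: rst_refl.
rewrite mem_cat => /orP[] /neighbours_step st /IH; apply: rst_trans.
  exact: rst_step.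
by apply: rst_sym; apply: rst_step; case: st => p s; apply: RelStep.
Qed.

(* The letters of u and v are numbered from 0 and the additional generators
   follow. Missing weights count as 1, missing precedences as 0. *)
Record certificate := Certificate {
  extras : seq (seq nat);  (* words defining the additional generators *)
  cert_rules : rules;
  weights : seq nat;
  precedence : seq nat;
  window : nat }.

Fixpoint lex_gt (x y : seq nat) : bool :=
  match x, y with
  | a :: x', b :: y' => (b < a) || (a == b) && lex_gt x' y'
  | _, _ => false
  end.

Definition weight (wt : nat -> nat) (w : seq nat) := sumn (map wt w).

Definition rule_decreases (wt pr : nat -> nat) (lr : seq nat * seq nat) : bool :=
  (weight wt lr.2 < weight wt lr.1) ||
  [&& weight wt lr.2 == weight wt lr.1, size lr.2 == size lr.1
    & lex_gt (map pr lr.1) (map pr lr.2)].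

Definition confluent (R : rules) : bool :=
  all (fun lr1 => all (fun lr2 => all (fun j => overlaps lr1 lr2 j ==>
    (nf R (reduct1 lr1 lr2 j) == nf R (reduct2 lr1 lr2 j)))
    (iota 0 (size lr1.1))) R) R.

Definition rev_rules (T : Type) (R : seq (seq T * seq T)) :=
  map (fun lr => (rev lr.1, rev lr.2)) R.

Definition expand (nb : nat) (ex : seq (seq nat)) (w : seq nat) : seq nat :=
  flatten [seq if i < nb then [:: i] else nth [::] ex (i - nb) | i <- w].

Definition offset_bound := 8.

Definition check_carries (bi : bool) (nl : nat) (c : certificate) : bool :=
  let R := cert_rules c in
  let q := (foldr maxn 1 [seq size lr.1 | lr <- R]).-1 in
  carries_ok (window c) offset_bound q R nl bi &&
  (bi ==> carries_ok (window c) offset_bound q (rev_rules R) nl bi).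

(** Besides termination and confluence, the rules must present the same semigroup: they identify [u]
    with [v] and each new letter with its word, and conversely every rule, with new letters
    expanded, follows from u = v in at most four steps. *)
Definition check_rewriting (nb : nat) (u v : seq nat) (c : certificate) : bool :=
  let R := cert_rules c in let ex := extras c in
  let nl := nb + size ex in
  [&& all (fun lr => [&& 0 < size lr.1, all (fun i => i < nl) lr.1
                       & all (fun i => i < nl) lr.2]) R,
      all (all (fun i => i < nb)) [:: u, v & ex],
      all (rule_decreases (nth 1 (weights c)) (nth 0 (precedence c))) R,
      confluent R,
      nf R u == nf R v,
      all (fun i => nf R [:: nb + i] == nf R (nth [::] ex i)) (iota 0 (size ex))
    & all (fun lr => convertible 4 u v (expand nb ex lr.1) (expand nb ex lr.2)) R].

Definition check_certificate (bi : bool) (nb : nat) (u v : seq nat)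
    (c : certificate) : bool :=
  check_rewriting nb u v c && check_carries bi (nb + size (extras c)) c.

Lemma critical_pairs_confluent R : confluent R -> critical_pairs_joinable R.
Proof.
move=> /allP cR lr1 lr2 j h1 h2 hj ov.
have /allP/(_ j) := allP (cR _ h1) _ h2; rewrite mem_iota => /(_ hj) /implyP /(_ ov) /eqP e.
by exists (nf R (reduct1 lr1 lr2 j)); split; [|rewrite e]; apply: normalize_red.
Qed.

Lemma irreducible_rev (T : eqType) (R : seq (seq T * seq T)) w :
  irreducible (rev_rules R) (rev w) = irreducible R w.
Proof.
congr negb; rewrite has_map; apply: eq_has => lr /=.
by rewrite infix_rev.
Qed.

Section Termination.
Variables (C : eqType) (pr : C -> nat) (b : nat).

(** The word as a numeral in base [b] with the precedences as digits: lexicographic comparison of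
    words of equal length becomes comparison of numbers. *)
Fixpoint horner (w : seq C) : nat :=
  if w is c :: w' then pr c * b ^ size w' + horner w' else 0.

Lemma horner_cat x y : horner (x ++ y) = horner x * b ^ size y + horner y.
Proof. by elim: x => //= c x ->; rewrite size_cat expnD; nia. Qed.

Hypothesis prb : forall c, pr c < b.

Lemma horner_bound w : horner w < b ^ size w.
Proof. by elim: w => //= c w IH; have := prb c; rewrite expnS; nia. Qed.

Lemma horner_lex x y : size y = size x -> lex_gt (map pr x) (map pr y) ->
  horner y < horner x.
Proof.
elim: x y => [|c x IH] [|d y] //= [es] /orP[lt|/andP[/eqP -> lt]].
  by have := horner_bound y; rewrite es; nia.
by rewrite es ltn_add2l; apply: IH.
Qed.

End Termination.

(** * From a certificate to automatic structures *)

Section Structure.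
Variables (n : nat) (a0 : 'I_n) (ls : seq 'I_n) (cu cv : seq nat).
Variables (bi : bool) (c : certificate).
Hypothesis uls : uniq ls.
Let nb := size ls.
Hypothesis okc : check_certificate bi nb cu cv c.

Let ex := extras c.
Let R := cert_rules c.
Let k := size ex.
Let nl := nb + k.
Let letter i : 'I_n := nth a0 ls i.
Let u := map letter cu.
Let v := map letter cv.
Let C : finType := ('I_n + 'I_k)%type.
Let P : pred nat := fun i => i < nl.

(** [C] contains the whole alphabet and the added generators, whereas the certificate numbers only
    the letters in [ls] and the added ones. The default [inl a0] is not reached below [nl]. *)
Definition embed (i : nat) : C :=
  if i < nb then inl (letter i) else oapp inr (inl a0) (insub (i - nb)).

Definition index_of (x : C) : nat :=
  match x with
  | inl a => if a \in ls then index a ls else nl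
  | inr j => nb + j
  end.

Let okr : check_rewriting nb cu cv c. Proof. by case/andP: okc. Qed.

Lemma index_embed i : P i -> index_of (embed i) = i.
Proof.
move=> Pi; rewrite /embed; case: ifP => hi /=.
  by rewrite mem_nth // index_uniq.
have hk : i - nb < k by move: Pi; rewrite /P /nl; lia.
by rewrite insubT /=; lia.
Qed.

Lemma embed_inj : {in P &, injective embed}.
Proof. by move=> i j Pi Pj e; rewrite -(index_embed Pi) e index_embed. Qed.

Lemma embed_base w : all (fun i => i < nb) w -> map embed w = map inl (map letter w).
Proof.
rewrite -map_comp => /allP h; apply/eq_in_map => i /h /= hi.
by rewrite /embed hi.
Qed.

Let RC := map_rules embed R.

Definition value (x : C) : seq 'I_n :=
  match x with inl a => [:: a] | inr j => map letter (nth [::] ex j) end.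
Definition values (w : seq C) : seq 'I_n := flatten (map value w).

Lemma values_cat x y : values (x ++ y) = values x ++ values y.
Proof. by rewrite /values map_cat flatten_cat. Qed.

Lemma values_inl w : values (map inl w) = w.
Proof. by elim: w => //= a w {2}<-. Qed.

Lemma values_embed w : all P w -> values (map embed w) = map letter (expand nb ex w).
Proof.
elim: w => //= i w IH /andP[Pi Pw].
rewrite /expand /= map_cat -/(expand nb ex w) -IH // /values /=; congr (_ ++ _).
rewrite /embed; case: ifP => //= hi.
have hk : i - nb < k by move: Pi; rewrite /P /nl; lia.
by rewrite insubT.
Qed.

Definition eqC (x y : seq C) : Prop := pres_cong u v (values x) (values y).

Lemma eqC_cong : congruence eqC.
Proof.
have [rf sy tr cg] := pres_cong_congruence u v.
split=> [x|x y|x y z|p s x y]; [exact: rf|exact: sy|exact: tr|].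
by rewrite /eqC !values_cat; apply: cg.
Qed.

Lemma lettersR : all (fun lr => all P lr.1 && all P lr.2) R.
Proof.
case/andP: okr => h _; apply: sub_all h => lr /and3P[_ h1 h2].
by apply/andP.
Qed.

Let PR : all (fun lr => all P lr.1) R.
Proof. by apply: sub_all lettersR => lr /andP[]. Qed.

Lemma sound_rules lr : lr \in R -> eqC (map embed lr.1) (map embed lr.2).
Proof.
move=> lrR; have /andP[h1 h2] := allP lettersR _ lrR.
rewrite /eqC !values_embed //; apply: pres_cong_map.
case/and5P: okr => _ _ _ _ /and3P[_ _ /allP /(_ _ lrR)].
exact: convertible_sound.
Qed.

Lemma sound_RC x y : red RC x y -> eqC x y.
Proof.
have [rf sy tr cg] := eqC_cong.
elim=> [x' y' [p s l r /mapP[lr lrR [-> ->]]]|x'|x' y' z _ h _ h'].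
- by apply: cg; apply: sound_rules.
- exact: rf.
- exact: tr h h'.
Qed.

Lemma wf_RC : well_founded (fun y x => rstep RC x y).
Proof.
pose wt x := nth 1 (weights c) (index_of x).
pose pr x := nth 0 (precedence c) (index_of x).
pose b := (\max_(x : C) pr x).+1.
have prb x : pr x < b by rewrite ltnS; apply: leq_bigmax.
apply: (@wf_rstep _ RC (fun w => sumn (map wt w)) (horner pr b)).
move=> _ _ [p s l r /mapP[lr lrR [-> ->]]].
have /andP[h1 h2] := allP lettersR _ lrR.
have ewt w : all P w -> map wt (map embed w) = map (nth 1 (weights c)) w.
  by move=> /allP Pw; rewrite -map_comp; apply/eq_in_map => i /Pw Pi; rewrite /= /wt index_embed.
have epr w : all P w -> map pr (map embed w) = map (nth 0 (precedence c)) w.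
  by move=> /allP Pw; rewrite -map_comp; apply/eq_in_map => i /Pw Pi; rewrite /= /pr index_embed.
have : rule_decreases (nth 1 (weights c)) (nth 0 (precedence c)) lr.
  by case/and4P: okr => _ _ /allP /(_ _ lrR).
rewrite !map_cat !sumn_cat !ewt // /rule_decreases /weight.
case/orP => [lt|/and3P[/eqP e /eqP es lx]]; first by left; lia.
right; split; first by lia.
rewrite !horner_cat !size_cat !size_map es.
rewrite ltn_add2l ltn_add2r ltn_pmul2r ?expn_gt0 //.
by apply: horner_lex; rewrite ?size_map // !epr.
Qed.

Lemma joinable_RC : critical_pairs_joinable RC.
Proof.
apply: (critical_pairs_map embed_inj PR); apply: critical_pairs_confluent.
by case/and5P: okr.
Qed.

Let conv := clos_refl_sym_trans _ (red RC).

Lemma conv_cat p s x y : conv x y -> conv (p ++ x ++ s) (p ++ y ++ s).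
Proof.
elim=> [x' y' r|x'|x' y' _|x' y' z _ h _ h'].
- by apply: rst_step; apply: red_cat.
- exact: rst_refl.
- exact: rst_sym.
- exact: rst_trans h h'.
Qed.

Lemma conv_nf_eq x y : nf R x = nf R y -> conv (map embed x) (map embed y).
Proof.
move=> e; apply: rst_trans (rst_step _ _ _ _ (red_map embed (normalize_red 60 R x))) _.
apply: rst_sym; apply: rst_step; rewrite -[normalize _ _ _]/(nf R x) e.
exact: red_map (normalize_red 60 R y).
Qed.

Lemma conv_values x : conv x (map inl (values x)).
Proof.
elim: x => [|x w IH]; first exact: rst_refl.
rewrite -cat1s values_cat map_cat.
apply: rst_trans (_ : conv ([:: x] ++ map inl (values w)) _).
  by have := conv_cat [:: x] [::] IH; rewrite !cats0.
suff H : conv [:: x] (map inl (values [:: x])).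
  exact: (@conv_cat [::] (map inl (values w)) _ _ H).
rewrite {w IH} /values /= cats0; case: x => [a|j].
  exact: rst_refl.
case/and5P: okr => _ hex _ _ /and3P[_ /allP hj _].
have jk : nat_of_ord j \in iota 0 (size (extras c)) by rewrite mem_iota ltn_ord.
have /eqP := hj _ jk => /conv_nf_eq /=.
have -> : embed (nb + j) = inr j.
  rewrite /embed ltnNge leq_addr /=.
  have -> : nb + j - nb = j by rewrite addKn.
  by rewrite valK.
rewrite embed_base //; apply: (allP hex); rewrite !inE; apply/orP; right; apply/orP; right.
exact: mem_nth.
Qed.

(** Expanding the added generators is a conversion, and so is an application of u = v, since both
    sides are rewritten to the same word. *)
Lemma eqC_conv x y : eqC x y -> conv x y.
Proof.
move=> h; apply: rst_trans (conv_values x) _.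
apply: rst_trans (rst_sym _ _ _ _ (conv_values y)).
elim: h => [x' y' [p s]|x'|x' y' _|x' y' z _ h1 _ h2].
- rewrite !map_cat; apply: conv_cat.
  case/and5P: okr => _ /and3P[hu hv _] _ _ /and3P[/eqP e _ _].
  by rewrite -(embed_base hu) -(embed_base hv); apply: conv_nf_eq.
- exact: rst_refl.
- exact: rst_sym.
- exact: rst_trans h1 h2.
Qed.

Lemma uniq_nf x y : eqC x y -> irreducible RC x -> irreducible RC y -> x = y.
Proof.
by move=> /eqC_conv; apply: conv_irreducible; [exact: wf_RC | exact: joinable_RC].
Qed.

(** Generators must be distinct in the semigroup, hence only irreducible letters are kept; [None]
    stands for the identity. *)
Definition generator := {x : option C | irreducible RC (oseq x)}.

Lemma irr_nil : irreducible RC [::].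
Proof.
apply/hasPn => _ /mapP[lr lrR ->]; rewrite infixs0 -size_eq0 size_map.
by case/andP: okr => /allP /(_ _ lrR) /and3P[]; case: size.
Qed.

Let G : finType := generator.
Let m := #|G|.
Let e : 'I_m := enum_rank (exist _ None irr_nil : G).
Let gval (b : 'I_m) : option C := sval (enum_val b).

Lemma gval_e b : (gval b == None) = (b == e).
Proof.
apply/eqP/eqP => [h|->]; last by rewrite /gval /e enum_rankK.
by apply: enum_val_inj; apply: val_inj; rewrite /e enum_rankK.
Qed.

Lemma gval_inj : injective gval.
Proof. by move=> b b' h; apply: enum_val_inj; apply: val_inj. Qed.

Local Notation lval := (letter_val gval).
Local Notation gvals := (vals lval).

Lemma irr_gval b : irreducible RC (lval b).
Proof. exact: (svalP (enum_val b)). Qed.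

Let g (b : 'I_m) : seq 'I_n := values (lval b).
Let L (w : seq 'I_m) : Prop := irr_lang e gval RC w.

Lemma evE w : ev g w = values (gvals w).
Proof.
by elim: w => //= b w IH; rewrite /ev /= -/(ev g w) IH (vals_cons gval) values_cat.
Qed.

Lemma gvals_cat s t : gvals (s ++ t) = gvals s ++ gvals t.
Proof. by rewrite /vals map_cat flatten_cat. Qed.

Lemma gvals_oseq a : gvals (oseq a) = oval lval a.
Proof. by case: a => //= b; rewrite /vals /= cats0. Qed.

Lemma lift_irr w : irreducible RC w -> exists s, e \notin s /\ gvals s = w.
Proof.
elim: w => [|x w IH] iw; first by exists [::].
have [s [es vs]] := IH (@irreducible_catr _ RC [:: x] w iw).
have ix : irreducible RC (oseq (Some x)) := @irreducible_catl _ RC [:: x] w iw.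
have hv : gval (enum_rank (exist _ (Some x) ix : G)) = Some x by rewrite /gval enum_rankK.
exists (enum_rank (exist _ (Some x) ix : G) :: s); split.
  by rewrite in_cons negb_or es andbT eq_sym -gval_e hv.
by rewrite (vals_cons gval) vs /letter_val hv.
Qed.

Lemma base_struct : base_structure (pres_cong u v) g L.
Proof.
split.
- move=> b b' h; have := uniq_nf (h : eqC _ _) (irr_gval b) (irr_gval b').
  rewrite /letter_val => ho; apply: gval_inj; case: (gval b) (gval b') ho => [x|] [y|] //=.
  by case=> ->.
- by move=> w /andP[+ _]; case: w.
- exact: regular_irr_lang.
move=> x; have [w [rw iw]] := exists_nf wf_RC (map inl x).
have [s [es vs]] := lift_irr iw.
have hE : pres_cong u v (values w) x.
  by have := sound_RC rw; rewrite /eqC values_inl; apply: rst_sym.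
case: s es vs => [|b s] es vs.
  exists [:: e]; split; last by rewrite evE (vals_e gval_e); move: hE; rewrite -vs.
  by rewrite /L /irr_lang /well_formed eqxx (vals_e gval_e); apply: irr_nil.
exists (b :: s); split; last by rewrite evE vs.
by rewrite /L /irr_lang /well_formed es orbT vs.
Qed.

Let q := (foldr maxn 1 [seq size lr.1 | lr <- R]).-1.
Let okR : carries_ok (window c) offset_bound q R nl bi.
Proof. by case/andP: okc => _ /andP[]. Qed.

Let K0 : 0 < window c. Proof. by case/and4P: okR. Qed.

Lemma chainC x al : irreducible RC al -> irreducible RC (oseq x) ->
  exists d out r, chain eqC (window c) offset_bound (oseq x)
    (if bi then Some offset_bound else None) al d out r /\ irreducible RC (d ++ out).
Proof.
move=> h1 h2.
exact: (chain_exists eqC_cong embed_inj lettersR sound_rules okR h1 h2).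
Qed.

Lemma auto_struct : automatic_structure (pres_cong u v) g L.
Proof.
split=> [|a]; first exact: base_struct.
apply: eq_regular (regular_right_padR gval_e eqC_cong uniq_nf irr_gval K0 chainC a) => w.
by split=> -[s [t [h1 h2 h3 h4]]]; exists s, t; split=> //; move: h3;
  rewrite !evE gvals_cat gvals_oseq.
Qed.

(** A nonempty prefix of a word of [L] is again in [L], so the prefix language is the equality
    language of the automatic structure. *)
Lemma certificate_prefix_automatic : prefix_automatic (pres_cong u v).
Proof.
exists m, g, L; split; first exact: auto_struct.
apply: eq_regular (proj2 auto_struct None) => w; split.
  move=> [s [t [Ls Lt h ->]]]; exists s, t; split=> //; last by rewrite cats0 in h.
  - by move: Lt => /andP[+ _]; case: (t).
  - by exists [::]; rewrite cats0.
move=> [s [t [Ls t0 [t' Lt] h ->]]]; exists s, t; split=> //; last by rewrite cats0.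
move: Lt; rewrite /L /irr_lang gvals_cat => /andP[wf /irreducible_catl ->].
rewrite andbT; move: wf; rewrite /well_formed mem_cat negb_or.
case: t t0 {h} => // b t _ /=; rewrite !eqseq_cons.
by move=> /orP[/andP[-> ]|/andP[-> _]]; [case: t | rewrite orbT].
Qed.

Lemma certificate_biautomatic : bi -> biautomatic (pres_cong u v).
Proof.
move=> hbi; exists m, g, L; split; first exact: base_struct.
have okR' : carries_ok (window c) offset_bound q (rev_rules R) nl bi.
  by case/andP: okc => _ /andP[_ /implyP]; apply.
pose eqC' x y := eqC (rev x) (rev y).
have [rf sy tr cg] := eqC_cong.
have cong' : congruence eqC'.
  split=> [x|x y|x y z|p s x y]; [exact: rf|exact: sy|exact: tr|].
  by rewrite /eqC' !rev_cat -!catA; apply: cg.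
pose RC' := map_rules embed (rev_rules R).
have eRC : RC' = rev_rules RC.
  by rewrite /RC' /map_rules /rev_rules -!map_comp; apply: eq_map => lr /=; rewrite !map_rev.
have irr' w : irreducible RC' w = irreducible RC (rev w).
  by rewrite eRC -[w in LHS]revK irreducible_rev.
have uniq' x y : eqC' x y -> irreducible RC' x -> irreducible RC' y -> x = y.
  rewrite !irr' => h h1 h2; apply: (can_inj (@revK _)); exact: uniq_nf.
have rval b : rev (lval b) = lval b by rewrite /letter_val; case: (gval b).
have irrg' b : irreducible RC' (lval b) by rewrite irr' rval; apply: irr_gval.
have letters' : all (fun lr => all P lr.1 && all P lr.2) (rev_rules R).
  by rewrite all_map; apply: sub_all lettersR => lr /=; rewrite !all_rev.
have sound' lr : lr \in rev_rules R -> eqC' (map embed lr.1) (map embed lr.2).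
  move=> /mapP[lr' lrR ->] /=; rewrite /eqC' -!map_rev !revK.
  exact: sound_rules.
have chain' x al : irreducible RC' al -> irreducible RC' (oseq x) ->
    exists d out r, chain eqC' (window c) offset_bound (oseq x)
      (if bi then Some offset_bound else None) al d out r /\ irreducible RC' (d ++ out).
  move=> h1 h2.
  exact: (chain_exists cong' embed_inj letters' sound' okR' h1 h2).
have L' w : irr_lang e gval RC' w = irr_lang e gval RC (rev w).
  by rewrite /irr_lang well_formed_rev irr' (vals_rev gval).
have lft s t a : eqC' (gvals s ++ oval lval a) (gvals t) <->
    pres_cong u v (ev g (oseq a ++ rev s)) (ev g (rev t)).
  rewrite /eqC' rev_cat /eqC !evE gvals_cat gvals_oseq !(vals_rev gval).
  have -> : rev (oval lval a) = oval lval a by case: (a) => [b|] //=; apply: rval.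
  by [].
move=> a; split.
- exact: (proj2 auto_struct a).
- apply: eq_regular (regular_right_padL gval_e eqC_cong uniq_nf irr_gval K0 chainC a hbi) => w.
  by split=> -[s [t [h1 h2 h3 h4]]]; exists s, t; split=> //; move: h3;
    rewrite !evE gvals_cat gvals_oseq.
(* Reversal exchanges the paddings: left multiplication padded on the right comes from right
   multiplication of reversed words padded on the left. *)
- have := regular_rev (regular_right_padL gval_e cong' uniq' irrg' K0 chain' a hbi).
  apply: eq_regular => w; split=> -[s [t [h1 h2 h3 h4]]].
    exists (rev s), (rev t); rewrite !L' in h1 h2; split=> //; first exact/lft.
    by rewrite -[w]revK h4 /padL revK.
  exists (rev s), (rev t); rewrite !L' !revK; split=> //; first by apply/lft; rewrite !revK.
  by rewrite h4 /padL !revK.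
- have := regular_rev (regular_right_padR gval_e cong' uniq' irrg' K0 chain' a).
  apply: eq_regular => w; split=> -[s [t [h1 h2 h3 h4]]].
    exists (rev s), (rev t); rewrite !L' in h1 h2; split=> //; first exact/lft.
    by rewrite /padL !revK -h4 revK.
  exists (rev s), (rev t); rewrite !L' !revK; split=> //; first by apply/lft; rewrite !revK.
  by rewrite h4 /padL revK.
Qed.

End Structure.

(** * All relations up to renaming of letters *)

(* Found by Knuth-Bendix completion. *)
Definition special_certificates : seq (seq nat * seq nat * certificate) := [::
  ([:: 0; 0], [:: 1; 1], Certificate [::]
    [:: ([:: 1; 1], [:: 0; 0]); ([:: 1; 0; 0], [:: 0; 0; 1])] [::] [:: 0; 1] 4);
  ([:: 0; 1; 0], [::], Certificate [::]
    [:: ([:: 1; 0], [:: 0; 1]); ([:: 0; 0; 1], [::])] [::] [:: 0; 1] 4);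
  ([:: 0; 1; 0], [:: 1], Certificate [::]
    [:: ([:: 0; 1; 0], [:: 1]); ([:: 1; 1; 0], [:: 0; 1; 1])] [::] [:: 0; 1] 4);
  ([:: 0; 0; 0], [:: 1; 0], Certificate [:: [:: 0; 0]]
        [:: ([:: 0; 0], [:: 2]); ([:: 1; 0], [:: 0; 2]); ([:: 1; 2], [:: 2; 2]); ([:: 2;
        0], [:: 0; 2])] [::] [:: 0; 2; 1] 2);
  ([:: 0; 0; 0], [:: 1; 1], Certificate [::]
    [:: ([:: 0; 0; 0], [:: 1; 1]); ([:: 1; 1; 0], [:: 0; 1; 1])] [::] [:: 0; 1] 4);
  ([:: 0; 0; 1], [:: 1; 1], Certificate [:: [:: 0; 0]]
        [:: ([:: 0; 0], [:: 2]); ([:: 2; 1], [:: 1; 1]); ([:: 2; 0], [:: 0; 2])] [::] [::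
        0; 1; 2] 2);
  ([:: 0; 1; 0], [:: 0; 1], Certificate [:: [:: 0; 1]]
    [:: ([:: 0; 1], [:: 2]); ([:: 2; 0], [:: 2]); ([:: 2; 1], [:: 2; 2])] [::] [:: 0; 2; 1] 1);
  ([:: 0; 1; 0], [:: 1; 1], Certificate [::]
    [:: ([:: 0; 1; 0], [:: 1; 1]); ([:: 1; 1; 1; 0], [:: 0; 1; 1; 1])] [::] [:: 0; 1] 6);
  ([:: 0; 1; 0], [:: 2; 0], Certificate [:: [:: 0; 1]]
        [:: ([:: 0; 1], [:: 3]); ([:: 2; 0], [:: 3; 0]); ([:: 2; 3], [:: 3; 3])] [::] [::
        0; 1; 3; 2] 1);
  ([:: 0; 1; 0], [:: 2; 2], Certificate [::]
    [:: ([:: 0; 1; 0], [:: 2; 2]); ([:: 2; 2; 1; 0], [:: 0; 1; 2; 2])] [::] [:: 0; 1; 2] 6);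
  ([:: 0; 1; 1], [:: 1; 0], Certificate [:: [:: 0; 1]]
    [:: ([:: 0; 1], [:: 2]); ([:: 2; 1], [:: 1; 0])] [::] [:: 0; 1; 2] 2);
  ([:: 0; 1; 2], [:: 2; 0], Certificate [:: [:: 0; 1]]
    [:: ([:: 0; 1], [:: 3]); ([:: 3; 2], [:: 2; 0])] [::] [:: 0; 1; 2; 3] 2);
  ([:: 0; 1; 2], [:: 2; 1], Certificate [:: [:: 0; 1]]
    [:: ([:: 0; 1], [:: 3]); ([:: 3; 2], [:: 2; 1])] [::] [:: 0; 1; 2; 3] 2);
  ([:: 0; 1; 2], [:: 2; 2], Certificate [:: [:: 0; 1]]
    [:: ([:: 0; 1], [:: 3]); ([:: 3; 2], [:: 2; 2])] [::] [:: 0; 1; 2; 3] 1);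
  ([:: 0; 0; 0], [:: 1; 0; 1], Certificate [:: [:: 0; 0]]
        [:: ([:: 0; 0], [:: 2]); ([:: 1; 0; 1], [:: 0; 2]); ([:: 2; 0], [:: 0; 2]); ([::
        2; 2; 1], [:: 1; 2; 2])] [::] [:: 0; 1; 2] 4);
  ([:: 0; 0; 0], [:: 1; 1; 1], Certificate [::]
    [:: ([:: 1; 1; 1], [:: 0; 0; 0]); ([:: 1; 0; 0; 0], [:: 0; 0; 0; 1])] [::] [:: 0; 1] 6);
  ([:: 0; 0; 0], [:: 1; 2; 1], Certificate [::]
    [:: ([:: 0; 0; 0], [:: 1; 2; 1]); ([:: 0; 1; 2; 1], [:: 1; 2; 1; 0])] [::] [:: 1; 0; 2] 6);
  ([:: 0; 1; 0], [:: 1; 0; 1], Certificate [:: [:: 0; 1]]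
        [:: ([:: 0; 1], [:: 2]); ([:: 2; 0], [:: 1; 2]); ([:: 1; 2; 1], [:: 2; 2]); ([::
        2; 2; 1], [:: 0; 2; 2])] [::] [:: 0; 1; 2] 4);
  ([:: 0; 1; 0], [:: 1; 1; 1], Certificate [:: [:: 0; 1]]
        [:: ([:: 0; 1], [:: 2]); ([:: 1; 1; 1], [:: 2; 0]); ([:: 1; 2; 0], [:: 2; 2]);
        ([:: 0; 2; 0], [:: 2; 1; 1]); ([:: 1; 2; 2], [:: 2; 2; 1]); ([:: 0; 2; 2], [:: 2;
        2; 0])] [::] [:: 1; 2; 0] 4);
  ([:: 0; 1; 0], [:: 1; 2; 1], Certificate [:: [:: 0; 1; 0]]
        [:: ([:: 0; 1; 0], [:: 3]); ([:: 1; 2; 1], [:: 3]); ([:: 3; 2; 1], [:: 1; 2; 3]);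
        ([:: 3; 1; 0], [:: 0; 1; 3])] [::] [:: 0; 1; 2; 3] 4);
  ([:: 0; 1; 0], [:: 2; 0; 2], Certificate [:: [:: 0; 1; 0]]
        [:: ([:: 0; 1; 0], [:: 3]); ([:: 2; 0; 2], [:: 3]); ([:: 3; 0; 2], [:: 2; 0; 3]);
        ([:: 3; 1; 0], [:: 0; 1; 3])] [::] [:: 0; 1; 2; 3] 4);
  ([:: 0; 1; 0], [:: 2; 1; 2], Certificate [:: [:: 0; 1]]
        [:: ([:: 0; 1], [:: 3]); ([:: 2; 1; 2], [:: 3; 0]); ([:: 2; 1; 3; 0], [:: 3; 3;
        2]); ([:: 2; 1; 3; 3], [:: 3; 3; 2; 1])] [::] [:: 0; 1; 3; 2] 6);
  ([:: 0; 1; 0], [:: 2; 2; 2], Certificate [::]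
    [:: ([:: 2; 2; 2], [:: 0; 1; 0]); ([:: 2; 0; 1; 0], [:: 0; 1; 0; 2])] [::] [:: 0; 1; 2] 6);
  ([:: 0; 1; 0], [:: 2; 3; 2], Certificate [:: [:: 0; 1; 0]]
        [:: ([:: 0; 1; 0], [:: 4]); ([:: 2; 3; 2], [:: 4]); ([:: 4; 3; 2], [:: 2; 3; 4]);
        ([:: 4; 1; 0], [:: 0; 1; 4])] [::] [:: 0; 1; 2; 3; 4] 4)
].

(** A single rule in either direction, with the first order that decreases it: one letter gets the
    highest precedence, either with all weights 1 or with weight 4 for that letter. *)
Definition simple_certificates (nb : nat) (u v : seq nat) : seq certificate :=
  if u == v then [:: Certificate [::] [::] [::] [::] 1] else
  let orders := flatten [seq
    let d := mkseq (fun i => nat_of_bool (i == c)) nb in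
    [:: ([::], d); (map (fun i => (3 * i).+1) d, d)] | c <- iota 0 nb] in
  flatten [seq [seq Certificate [::] [:: lr] o.1 o.2 4
               | o <- take 1 [seq o <- orders | rule_decreases (nth 1 o.1) (nth 0 o.2) lr]]
          | lr <- [:: (u, v); (v, u)]].

Definition candidates (nb : nat) (u v : seq nat) : seq certificate :=
  [seq t.2 | t <- special_certificates & t.1 == (u, v)] ++ simple_certificates nb u v.

Definition exceptional1 (u v : seq nat) : bool := (u, v) \in
  [:: ([:: 0; 1; 0], [:: 1; 0]); ([:: 0; 0; 1], [:: 1; 0]); ([:: 0; 1; 1], [:: 1; 1])].
Definition exceptional2 (u v : seq nat) : bool :=
  (u, v) \in [:: ([:: 0; 1], [:: 0]); ([:: 0; 1], [:: 1])].
Definition claims_bi (u v : seq nat) : bool :=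
  (size u == 3) && ((size v == 0) || (size v == 3)) ||
  (size u == 2) && ~~ exceptional2 u v.

Definition certified (u v : seq nat) (nb : nat) : bool :=
  exceptional1 u v ||
  has (check_certificate (claims_bi u v) nb u v) (candidates nb u v).

(* The words of length n in which new letters appear in the order k, k+1, ...,
   each with the number of letters used. *)
Fixpoint growth_words (k n : nat) : seq (seq nat * nat) :=
  if n is n'.+1 then
    flatten [seq [seq (i :: t.1, t.2) | t <- growth_words (if i == k then k.+1 else k) n']
            | i <- iota 0 k.+1]
  else [:: ([::], k)].

Lemma growth_wordsS k n : growth_words k n.+1 = flatten
  [seq [seq (i :: t.1, t.2) | t <- growth_words (if i == k then k.+1 else k) n]
  | i <- iota 0 k.+1].
Proof. by []. Qed.

Definition all_certified : bool :=
  all (fun lu => all (fun lv =>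
    all (fun t => certified (take lu t.1) (drop lu t.1) t.2) (growth_words 0 (lu + lv)))
    (iota 0 lu.+1)) (iota 0 4).

Lemma all_certified_true : all_certified.
Proof. by vm_cast_no_check (erefl true). Qed.

(** The letters in order of first occurrence. Replacing each letter by its index yields a growth
    word, which brings an arbitrary relation to one of the finitely many checked. *)
Fixpoint firsts (T : eqType) (acc s : seq T) : seq T :=
  if s is x :: s' then firsts (if x \in acc then acc else rcons acc x) s' else acc.

Section Canonical.
Variable T : eqType.
Implicit Types acc s : seq T.

Lemma firsts_prefix acc s : exists t, firsts acc s = acc ++ t.
Proof.
elim: s acc => [|x s IH] acc /=; first by exists [::]; rewrite cats0.
have [t ->] := IH (if x \in acc then acc else rcons acc x); case: ifP => _.
  by exists t.
by exists (x :: t); rewrite cat_rcons.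
Qed.

Lemma firsts_uniq acc s : uniq acc -> uniq (firsts acc s).
Proof.
elim: s acc => [|x s IH] acc //= ua; apply: IH; case: ifP => // hx.
by rewrite rcons_uniq hx.
Qed.

Lemma mem_firsts acc s : {subset s <= firsts acc s}.
Proof.
elim: s acc => [|x s IH] acc y //=; rewrite inE => /orP[/eqP ->|]; last exact: IH.
have [t ->] := firsts_prefix (if x \in acc then acc else rcons acc x) s.
by rewrite mem_cat; case: ifP => [-> //|_]; rewrite mem_rcons inE eqxx.
Qed.

Lemma firsts_growth acc s :
  (map (index^~ (firsts acc s)) s, size (firsts acc s)) \in growth_words (size acc) (size s).
Proof.
elim: s acc => [|x s IH] acc; first by rewrite inE.
rewrite [size (x :: s)]/= growth_wordsS [firsts _ _]/=.
set acc' := if x \in acc then acc else rcons acc x.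
have [t et] := firsts_prefix acc' s.
set i := index x (firsts acc' s).
have hi : i <= size acc /\ size acc' = (if i == size acc then (size acc).+1 else size acc).
  rewrite /i et index_cat /acc'; case: (boolP (x \in acc)) => hx.
    rewrite hx; have := hx; rewrite -index_mem => hlt.
    by split; [apply: ltnW | rewrite ltn_eqF].
  rewrite mem_rcons inE eqxx /= -cats1 index_cat (negbTE hx) /= eqxx addn0 eqxx size_cat /=.
  by rewrite addn1.
apply/flatten_mapP; exists i; first by rewrite mem_iota add0n ltnS; case: hi.
apply/mapP; exists (map (index^~ (firsts acc' s)) s, size (firsts acc' s)) => //.
by case: hi => _ <-; apply: IH.
Qed.

End Canonical.

Lemma canonical_certified (T : eqType) (u v : seq T) :
  size v <= size u -> size u <= 3 ->
  forall ls, ls = firsts [::] (u ++ v) ->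
  certified (map (index^~ ls) u) (map (index^~ ls) v) (size ls).
Proof.
move=> h1 h2 _ ->; have := allP all_certified_true (size u); rewrite mem_iota => /(_ h2).
move=> /allP /(_ (size v)); rewrite mem_iota => /(_ h1) /allP.
have := firsts_growth [::] (u ++ v); rewrite size_cat => hg /(_ _ hg) /=.
by rewrite map_cat take_size_cat ?drop_size_cat ?size_map.
Qed.

Section Positive.
Variables (n : nat) (u v : seq 'I_n).
Hypotheses (n2 : 2 <= n) (vu : size v <= size u) (u3 : size u <= 3).

Let ls := firsts [::] (u ++ v).
Let a0 : 'I_n := Ordinal (ltnW n2).
Let cu := map (index^~ ls) u.
Let cv := map (index^~ ls) v.

Lemma canonicalK w : {subset w <= u ++ v} -> map (nth a0 ls) (map (index^~ ls) w) = w.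
Proof.
move=> sub; rewrite -map_comp -[RHS]map_id; apply/eq_in_map => x /sub xw /=.
by rewrite nth_index // mem_firsts.
Qed.

Lemma cuK : map (nth a0 ls) cu = u.
Proof. by apply: canonicalK => x xu; rewrite mem_cat xu. Qed.
Lemma cvK : map (nth a0 ls) cv = v.
Proof. by apply: canonicalK => x xv; rewrite mem_cat xv orbT. Qed.

Lemma exceptional1_bad : exceptional1 cu cv -> bad_rel1 u v.
Proof.
move=> h; exists (nth a0 ls 0), (nth a0 ls 1); split.
  move=> e; have ei : forall i j, i \in cu -> j \in cu -> nth a0 ls i = nth a0 ls j -> i = j.
    move=> i j /mapP[x xu ->] /mapP[y yu ->]; rewrite !nth_index ?mem_firsts ?mem_cat ?xu ?yu //.
    by move=> ->.
  have [h0 h1] : 0 \in cu /\ 1 \in cu.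
    by move: h; rewrite /exceptional1 !inE !xpair_eqE => /or3P[] /andP[/eqP -> _].
  by have := ei 0 1 h0 h1 e.
rewrite -{1 2 3}cuK -{1 2 3}cvK.
move: h; rewrite /exceptional1 !inE !xpair_eqE.
by move=> /or3P[] /andP[/eqP -> /eqP ->]; [apply: Or31 | apply: Or32 | apply: Or33].
Qed.

Lemma exceptional2_bad : exceptional2 cu cv -> bad_rel2 u v.
Proof.
move=> h; exists (nth a0 ls 0), (nth a0 ls 1); split.
  move=> e; have ei : forall i j, i \in cu -> j \in cu -> nth a0 ls i = nth a0 ls j -> i = j.
    move=> i j /mapP[x xu ->] /mapP[y yu ->]; rewrite !nth_index ?mem_firsts ?mem_cat ?xu ?yu //.
    by move=> ->.
  have [h0 h1] : 0 \in cu /\ 1 \in cu.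
    by move: h; rewrite /exceptional2 !inE !xpair_eqE => /orP[] /andP[/eqP -> _].
  by have := ei 0 1 h0 h1 e.
rewrite -{1 2}cuK -{1 2}cvK.
move: h; rewrite /exceptional2 !inE !xpair_eqE.
by move=> /orP[] /andP[/eqP -> /eqP ->]; [left | right].
Qed.

Lemma positive_certificate : ~ bad_rel1 u v ->
  exists c, check_certificate (claims_bi cu cv) (size ls) cu cv c.
Proof.
move=> nb; have /orP[h|h] := canonical_certified vu u3 erefl.
  by case: nb; apply: exceptional1_bad.
elim: (candidates _ _ _) h => //= c s IH /orP[hc|/IH //].
by exists c.
Qed.

Lemma positive_prefix_automatic : ~ bad_rel1 u v -> prefix_automatic (pres_cong u v).
Proof.
move=> /positive_certificate[c hc].
have := certificate_prefix_automatic a0 (@firsts_uniq _ [::] (u ++ v) isT) hc.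
by rewrite -/ls cuK cvK.
Qed.

Lemma positive_biautomatic :
  (size u = 3 /\ size v = 0) \/ (size u = 3 /\ size v = 3) \/
  (size u = 2 /\ ~ bad_rel2 u v) -> biautomatic (pres_cong u v).
Proof.
move=> hb; have bi : claims_bi cu cv.
  rewrite /claims_bi !size_map; case: hb => [[-> ->] //|[[-> ->] //|[-> nb]]].
  by apply/negP => /exceptional2_bad.
have [c hc] : exists c, check_certificate (claims_bi cu cv) (size ls) cu cv c.
  (* The exceptional relations of part (1) have |u| = 3 and |v| = 2, which none of (i), (ii), (iii)
     allows. *)
  apply: positive_certificate => -[a [b [_ h]]]; move: hb.
  by case: h => -[-> ->] /=; case=> [[]|[[]|[]]].
have := certificate_biautomatic a0 (@firsts_uniq _ [::] (u ++ v) isT) hc bi.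
by rewrite -/ls cuK cvK.
Qed.

End Positive.

(** * Obstructions to automaticity *)

Lemma ev_cat (A : Type) (m : nat) (g : 'I_m -> seq A) s t :
  ev g (s ++ t) = ev g s ++ ev g t.
Proof. by rewrite /ev map_cat flatten_cat. Qed.

Lemma ev_oseq (A : Type) (m : nat) (g : 'I_m -> seq A) c :
  ev g (oseq (Some c)) = g c.
Proof. by rewrite /ev /= cats0. Qed.

Lemma ev_size (A : Type) (m : nat) (g : 'I_m -> seq A) w :
  size (ev g w) <= (\max_b size (g b)) * size w.
Proof.
elim: w => [|b w IH] //; rewrite [ev _ _]/= size_cat mulnS.
by apply: leq_add IH; apply: (@leq_bigmax _ (fun b => size (g b))).
Qed.

Lemma ev_singleton (A : eqType) (m : nat) (g : 'I_m -> seq A) w (y : A) :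
  ev g w = [:: y] -> exists b, g b = [:: y].
Proof.
elim: w => // b w IH; rewrite /ev /= -/(ev g w); case e: (g b) => [|z s] /=; first exact: IH.
by case=> ez h; exists b; rewrite e ez; case: s h {e}.
Qed.

Lemma dfa_pump (T : Type) k (d : 'I_k -> T -> 'I_k) q w : k <= size w ->
  exists x y z, [/\ w = x ++ y ++ z, 0 < size y & foldl d q (x ++ y) = foldl d q x].
Proof.
move=> hk; pose f (i : 'I_(size w).+1) := foldl d q (take i w).
have /injectivePn[i [j nij e]] : ~~ injectiveb f.
  by apply/negP => /injectiveP /leq_card; rewrite !card_ord ltnNge hk.
wlog lt : i j nij e / i < j.
  move=> H; case: (ltngtP i j) => [|lt|/ord_inj eij]; first exact: H.
    by apply: (H j i) => //; rewrite eq_sym.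
  by rewrite eij eqxx in nij.
exists (take i w), (take (j - i) (drop i w)), (drop (j - i) (drop i w)).
have hj := ltn_ord j; rewrite !cat_take_drop -takeD subnKC ?(ltnW lt) //; split=> //.
by rewrite size_take size_drop; case: ifP; lia.
Qed.

Lemma padR_catl (X : Type) (s1 s2 t : seq X) : size s1 = size t ->
  padR (s1 ++ s2) t = padR s1 t ++ map (fun a => (Some a, None)) s2.
Proof.
elim: s1 t => [|a s1 IH] [|b t] //=; last by move=> [/IH e]; rewrite !padRE e.
by move=> _; elim: s2 => // a s2 IH; rewrite padRE IH.
Qed.

Lemma padR_catr (X : Type) (s t1 t2 : seq X) : size s = size t1 ->
  padR s (t1 ++ t2) = padR s t1 ++ map (fun b => (None, Some b)) t2.
Proof.
elim: s t1 => [|a s IH] [|b t1] //=; last by move=> [/IH e]; rewrite !padRE e.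
by move=> _; elim: t2 => // b t2 IH; rewrite padRE IH.
Qed.

Lemma padL_catl (X : Type) (s1 s2 t : seq X) : size s2 = size t ->
  padL (s1 ++ s2) t = map (fun a => (Some a, None)) s1 ++ padL s2 t.
Proof.
by move=> e; rewrite /padL rev_cat padR_catl ?size_rev // rev_cat -map_rev revK.
Qed.

(** A word containing neither [u] nor [v] admits no step in either direction, so its class is a
    singleton. *)
Lemma isolated (A : eqType) (u v x y : seq A) : pres_cong u v x y ->
  (~~ infix u x -> ~~ infix v x -> x = y) /\ (~~ infix u y -> ~~ infix v y -> x = y).
Proof.
elim=> [x' y' [p s]|x'|x' y' _ [h h']|x' y' z _ [h1 h2] _ [h3 h4]] //.
- split=> [/negP []|_ /negP []]; apply/infixP; by exists p, s.
- by split=> i1 i2; symmetry; [apply: h' | apply: h].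
- split=> i1 i2; first by have e := h1 i1 i2; rewrite e in i1 i2 *; apply: h3.
  by have e := h4 i1 i2; rewrite -e in i1 i2 *; apply: h2.
Qed.

Lemma infix_sorted (A : eqType) (r : rel A) x y w :
  infix [:: x; y] w -> sorted r w -> r x y.
Proof.
by move=> /infixP[p [s ->]] /cat_sorted2 [_ /cat_sorted2 [/= /andP[]]].
Qed.

(** The letter is alone in its class, so a word of generators representing it evaluates to it
    exactly, and one of them is the letter itself. *)
Lemma letter_generator (A : eqType) (u v : seq A) m (g : 'I_m -> seq A) L y :
  base_structure (pres_cong u v) g L -> ~~ infix u [:: y] -> ~~ infix v [:: y] ->
  exists b, g b = [:: y].
Proof.
move=> [_ _ _ sur] iu iv; have [w [_ h]] := sur [:: y].
by apply: (ev_singleton (w := w)); apply: (isolated h).2.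
Qed.

(* The state reached after |be_j| letters on the pair (al_j, be_j) cannot be
   shared by two indices j, since the rest of al_j determines j through the
   invariant [count_mem b]. *)
Lemma not_automatic_collapse (A : eqType) (u v : seq A) (a b y : A)
    (rest t : nat -> seq A) :
  a != b -> ~~ infix u [:: y] -> ~~ infix v [:: y] ->
  (forall x z, pres_cong u v x z -> count_mem b x = count_mem b z) ->
  (forall i j, ~~ infix u (nseq i a ++ rest j)) ->
  (forall i j, ~~ infix v (nseq i a ++ rest j)) ->
  (forall j, count_mem b (rest j) = j.+1) ->
  (forall i j, pres_cong u v ((nseq i a ++ rest j) ++ [:: y]) (t j)) ->
  ~ automatic (pres_cong u v).
Proof.
move=> ab iuy ivy cnt iu iv crest st [m [g [L [base auto]]]].
have [c gc] := letter_generator base iuy ivy.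
have ec : ev g (oseq (Some c)) = [:: y] by rewrite ev_oseq.
have [_ _ _ sur] := base.
have [k [q0 [d [F HF]]]] := auto (Some c).
pose M := \max_x size (g x).
(* The exponent exceeds the length of the value of any |be| generators: the first |be| letters of
   [al] evaluate to a power of [a], and the rest of [al] is read against padding. *)
pose good (j : nat) (q : 'I_k) := exists al be i,
  [/\ L al, L be, ev g al = nseq i a ++ rest j /\ pres_cong u v (ev g be) (t j),
      M * size be < i & foldl d q0 (padR (take (size be) al) be) = q].
have ex j : exists q, good j q.
  have [be [Lbe ebe]] := sur (t j).
  have [al [Lal eal]] := sur (nseq (M * size be).+1 a ++ rest j).
  eexists; exists al, be, (M * size be).+1; split=> //; split=> //.
  exact: (isolated eal).2.
have short al (be : seq 'I_m) i j : ev g al = nseq i a ++ rest j -> M * size be < i ->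
    size be <= size al /\ count_mem b (ev g (take (size be) al)) = 0.
  move=> e hi.
  have hs : size (ev g (take (size be) al)) < i.
    apply: leq_ltn_trans hi; apply: leq_trans (ev_size g _) _.
    by rewrite leq_mul2l size_take; case: ifP => h; rewrite ?leqnn ?orbT // leqNgt h orbT.
  split.
    rewrite leqNgt; apply/negP => lt; move: hs; rewrite take_oversize ?(ltnW lt) // e.
    by rewrite size_cat size_nseq ltnNge leq_addr.
  have := congr1 (take (size (ev g (take (size be) al)))) e.
  rewrite -{2}(cat_take_drop (size be) al) ev_cat take_size_cat // => ->.
  rewrite takel_cat ?size_nseq ?(ltnW hs) // take_nseq ?(ltnW hs) //.
  by rewrite count_nseq /= (negbTE ab).
have uniqq j j' q : good j q -> good j' q -> j = j'.
  move=> [al [be [i [Lal Lbe [eal ebe] hi eq1]]]] [al' [be' [i' [Lal' Lbe' [eal' ebe'] hi' eq2]]]].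
  have [s1 c1] := short _ _ _ _ eal hi; have [s2 c2] := short _ _ _ _ eal' hi'.
  have acc' : dfa_accepts d q0 F (padR al' be').
    apply/HF; exists al', be'; split=> //; rewrite ev_cat ec eal'.
    by apply: rst_trans (st i' j') _; apply: rst_sym.
  (* The end of [al'] is grafted onto the beginning of [al]; the common state makes the automaton
     accept this word with [be]. *)
  have acc : dfa_accepts d q0 F (padR (take (size be) al ++ drop (size be') al') be).
    rewrite padR_catl ?size_takel //; move: acc'.
    rewrite /dfa_accepts -{1}(cat_take_drop (size be') al') padR_catl ?size_takel //.
    by rewrite !foldl_cat eq1 eq2.
  have [al2 [be2 [_ _ e2 ep]]] := (HF _).2 acc.
  have [p1 p2] := padR_proj (take (size be) al ++ drop (size be') al') be.
  have [p3 p4] := padR_proj al2 be2.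
  rewrite ep p3 in p1; rewrite ep p4 in p2; subst al2 be2.
  have eC := cnt _ _ e2; rewrite !ev_cat !count_cat c1 add0n (cnt _ _ ebe) in eC.
  rewrite gc -(cnt _ _ (st 0 j)) !count_cat crest /= in eC.
  have := congr1 (count_mem b) eal'; rewrite -{1}(cat_take_drop (size be') al') ev_cat.
  rewrite !count_cat c2 crest count_nseq /= (negbTE ab) /=; move: eC.
  by lia.
pose f (j : 'I_k.+1) := sval (constructive_indefinite_description _ (ex j)).
have fP (j : 'I_k.+1) : good j (f j) by apply: svalP.
have /leq_card : injective f.
  by move=> j j' e; apply: val_inj; apply: (uniqq _ _ (f j)); [|rewrite e]; apply: fP.
by rewrite !card_ord ltnn.
Qed.

Lemma pres_cong_invariant (A T : Type) (f : seq A -> T) (u v : seq A) :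
  (forall p s, f (p ++ u ++ s) = f (p ++ v ++ s)) ->
  forall x y, pres_cong u v x y -> f x = f y.
Proof.
by move=> H x y; elim=> [x' y' [p s]|x'|x' y' _ ->|x' y' z _ -> _ ->].
Qed.

Section NotAutomatic.
Variables (A : eqType) (a b : A).
Hypothesis ab : a != b.
Let ba : b != a. Proof. by rewrite eq_sym. Qed.

Lemma aba_ba_not_automatic : ~ automatic (pres_cong [:: a; b; a] [:: b; a]).
Proof.
set u := [:: a; b; a]; set v := [:: b; a].
have [rf sy tr cg] := pres_cong_congruence u v.
have sorted_s i j : sorted (fun x y => ~~ ((x == b) && (y == a))) (nseq i a ++ nseq j.+1 b).
  elim: i => [|i IH]; first by elim: j => //= j IH; rewrite (negbTE ba) andbF.
  by case: i IH => [|i] /= IH; rewrite (negbTE ab).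
have iv i j : ~~ infix v (nseq i a ++ nseq j.+1 b).
  by apply/negP => /infix_sorted /(_ (sorted_s i j)); rewrite !eqxx.
(* An inserted a makes the shorter case applicable: a b^(k+1) ba = (a b^(k+1) a) ba = b^(k+1) aba =
   b^(k+1) ba. *)
have step k : pres_cong u v (a :: nseq k.+1 b ++ [:: a]) (nseq k.+1 b ++ [:: a]).
  elim: k => [|k IH]; first by have := rst_step _ _ _ _ (RelStep u v [::] [::]).
  have e1 : nseq k.+2 b ++ [:: a] = nseq k.+1 b ++ [:: b; a].
    by rewrite -[k.+2]addn1 nseqD -catA.
  apply: (tr _ ((a :: nseq k.+1 b ++ [:: a; b; a]))).
    by rewrite e1; have := sy _ _ (rst_step _ _ _ _ (RelStep u v (a :: nseq k.+1 b) [::])).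
  apply: (tr _ (((nseq k.+1 b ++ [:: a]) ++ [:: b; a]))).
    by have := cg [::] [:: b; a] _ _ IH; rewrite /= -!catA.
  by rewrite e1 -catA; have := rst_step _ _ _ _ (RelStep u v (nseq k.+1 b) [::]).
apply: (@not_automatic_collapse _ u v a b a (fun j => nseq j.+1 b)
  (fun j => nseq j.+1 b ++ [:: a])) => //.
- by apply/negP => /size_infix.
- by apply/negP => /size_infix.
- by apply: pres_cong_invariant => p s; rewrite !count_cat /= (negbTE ab).
- move=> i j; apply: contra (iv i j) => /(infix_trans _); apply.
  by apply/infixP; exists [:: a], [::].
- by move=> j; rewrite count_nseq /= eqxx mul1n.
elim=> [|i IH] j; first exact: rf.
apply: (tr _ ((a :: nseq j.+1 b ++ [:: a]))); last exact: step.
by have := cg [:: a] [::] _ _ (IH j); rewrite !cats0.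
Qed.

Lemma abb_bb_not_automatic : ~ automatic (pres_cong [:: a; b; b] [:: b; b]).
Proof.
set u := [:: a; b; b]; set v := [:: b; b].
have [rf sy tr cg] := pres_cong_congruence u v.
(* The word b(ab)^j avoids bb, has j+1 letters b, and becomes b^(j+2) after multiplication by b,
   every a being absorbed. *)
pose X j := flatten (nseq j [:: a; b]).
have sorted_s i j : sorted (fun x y => ~~ ((x == b) && (y == b))) (nseq i a ++ b :: X j).
  elim: i => [|i IH] /=; last by case: i IH => [|i] /= IH; rewrite (negbTE ab).
  by elim: j => //= j IH; rewrite (negbTE ab) andbF.
have iv i j : ~~ infix v (nseq i a ++ b :: X j).
  by apply/negP => /infix_sorted /(_ (sorted_s i j)); rewrite !eqxx.
have absorb j : pres_cong u v (a :: nseq j.+2 b) (nseq j.+2 b).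
  exact: rst_step (RelStep u v [::] (nseq j b)).
apply: (@not_automatic_collapse _ u v a b b (fun j => b :: X j) (fun j => nseq j.+2 b)) => //.
- by apply/negP => /size_infix.
- by apply/negP => /size_infix.
- by apply: pres_cong_invariant => p s; rewrite !count_cat /= (negbTE ab).
- move=> i j; apply: contra (iv i j) => /(infix_trans _); apply.
  by apply/infixP; exists [:: a], [::].
- by move=> j; rewrite /= eqxx; congr _.+1; elim: j => //= j ->; rewrite (negbTE ab) eqxx.
elim=> [|i IH] j; last first.
  apply: (tr _ _ _ _ (absorb j)).
  by have := cg [:: a] [::] _ _ (IH j); rewrite !cats0.
rewrite /=; elim: j => [|j IH]; first exact: rf.
apply: (tr _ ((b :: a :: nseq j.+2 b))).
  by have := cg [:: b; a] [::] _ _ IH; rewrite !cats0.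
by have := cg [:: b] [::] _ _ (absorb j); rewrite !cats0.
Qed.

End NotAutomatic.

(** * Lengths of shortest representatives *)

Section Shortest.
Variables (A : Type) (E : seq A -> seq A -> Prop) (m : nat) (g : 'I_m -> seq A).
Variable L : seq 'I_m -> Prop.
Hypothesis base : base_structure E g L.

Definition shortest (x : seq A) (al : seq 'I_m) : Prop :=
  [/\ L al, E (ev g al) x &
    forall al', L al' -> E (ev g al') x -> size al <= size al'].

Lemma shortest_exists x : exists al, shortest x al.
Proof.
have [_ _ _ sur] := base; have [al [Lal eal]] := sur x.
have [k] := ubnP (size al); elim: k al Lal eal => // k IH al Lal eal hk.
case: (excluded_middle_informative (exists al', [/\ L al', E (ev g al') x &
  size al' < size al])) => [[al' [L' e' lt]]|no].
  by apply: (IH al') => //; lia.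
exists al; split=> // al' L' e'; rewrite leqNgt; apply/negP => lt.
by apply: no; exists al'.
Qed.

Hypothesis congE : congruence E.
Variables (c : 'I_m) (k : nat) (q0 : 'I_k).
Variables (d : 'I_k -> option 'I_m * option 'I_m -> 'I_k) (F : pred 'I_k).
Hypothesis dfa : forall w, L_right_padR E g L (Some c) w <-> dfa_accepts d q0 F w.

Lemma dfa_pair al be : dfa_accepts d q0 F (padR al be) ->
  [/\ L al, L be & E (ev g al ++ g c) (ev g be)].
Proof.
move=> /dfa[al' [be' [h1 h2 h3 e]]].
have [p1 p2] := padR_proj al be; have [p3 p4] := padR_proj al' be'.
rewrite e p3 in p1; rewrite e p4 in p2; subst al' be'; split=> //.
by move: h3; rewrite ev_cat ev_oseq.
Qed.

(** If [be] were more than [k] letters longer than [al], its tail facing padding would contain a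
    loop; cutting it out leaves a shorter representative of [y]. *)
Lemma shortest_mul x y al be : E (x ++ g c) y ->
  L al -> E (ev g al) x -> shortest y be -> size be <= size al + k.
Proof.
move=> exy Lal eal [Lbe ebe mbe]; case: congE => _ sy tr cg.
rewrite leqNgt; apply/negP => lt.
have acc : dfa_accepts d q0 F (padR al be).
  apply/dfa; exists al, be; split=> //; rewrite ev_cat ev_oseq.
  by apply: (tr _ (x ++ g c)); [exact: (cg [::] (g c)) | exact: (tr _ _ _ exy (sy _ _ ebe))].
have hs : size al <= size be by lia.
have e1 : size al = size (take (size al) be) by rewrite size_takel.
move: acc; rewrite /dfa_accepts -{1}(cat_take_drop (size al) be) padR_catr // foldl_cat.
have [|p [r [s [ew r0 eq]]]] := @dfa_pump _ k d
    (foldl d q0 (padR al (take (size al) be)))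
    (map (fun b => (None, Some b)) (drop (size al) be)).
  by rewrite size_map size_drop; lia.
rewrite ew !foldl_cat in eq *; rewrite eq => acc.
have [p' [rs [ed ep ers]]] : exists p' rs, [/\ drop (size al) be = p' ++ rs,
    p = map (fun b => (None, Some b)) p' & r ++ s = map (fun b => (None, Some b)) rs].
  exists (take (size p) (drop (size al) be)), (drop (size p) (drop (size al) be)).
  by rewrite cat_take_drop map_take [map _ (drop (size p) _)]map_drop ew take_size_cat // drop_size_cat.
have [s' [es lts]] : exists s', s = map (fun b => (None, Some b)) s' /\ size s' < size rs.
  exists (drop (size r) rs); rewrite map_drop -ers drop_size_cat //; split=> //.
  have := congr1 size ers; rewrite size_cat size_map size_drop; lia.
have := @dfa_pair al (take (size al) be ++ p' ++ s').
rewrite padR_catr // /dfa_accepts foldl_cat map_cat -ep -es foldl_cat.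
move=> /(_ acc) [_ L' e'].
have := mbe _ L'; rewrite !size_cat -e1.
have := congr1 size ed; rewrite size_cat size_drop => hsz.
move=> H; have : E (ev g (take (size al) be ++ p' ++ s')) y.
  apply: (tr _ _ _ (sy _ _ e')); apply: (tr _ _ _ _ exy); exact: (cg [::] (g c)).
by move=> /H; lia.
Qed.

(** The same loop argument on the tail of [al]; cancellation of the generator shows that the
    shortened word still represents [x]. *)
Lemma shortest_div x y al be : E (x ++ g c) y ->
  (forall x', E (x' ++ g c) y -> E x' x) ->
  L be -> E (ev g be) y -> shortest x al -> size al <= size be + k.
Proof.
move=> exy canc Lbe ebe [Lal eal mal]; case: congE => _ sy tr cg.
rewrite leqNgt; apply/negP => lt.
have acc : dfa_accepts d q0 F (padR al be).
  apply/dfa; exists al, be; split=> //; rewrite ev_cat ev_oseq.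
  by apply: (tr _ (x ++ g c)); [exact: (cg [::] (g c)) | exact: (tr _ _ _ exy (sy _ _ ebe))].
have hs : size be <= size al by lia.
have e1 : size (take (size be) al) = size be by rewrite size_takel.
move: acc; rewrite /dfa_accepts -{1}(cat_take_drop (size be) al) padR_catl // foldl_cat.
have [|p [r [s [ew r0 eq]]]] := @dfa_pump _ k d
    (foldl d q0 (padR (take (size be) al) be))
    (map (fun b => (Some b, None)) (drop (size be) al)).
  by rewrite size_map size_drop; lia.
rewrite ew !foldl_cat in eq *; rewrite eq => acc.
have [p' [rs [ed ep ers]]] : exists p' rs, [/\ drop (size be) al = p' ++ rs,
    p = map (fun b => (Some b, None)) p' & r ++ s = map (fun b => (Some b, None)) rs].
  exists (take (size p) (drop (size be) al)), (drop (size p) (drop (size be) al)).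
  by rewrite cat_take_drop map_take [map _ (drop (size p) _)]map_drop ew take_size_cat // drop_size_cat.
have [s' [es lts]] : exists s', s = map (fun b => (Some b, None)) s' /\ size s' < size rs.
  exists (drop (size r) rs); rewrite map_drop -ers drop_size_cat //; split=> //.
  have := congr1 size ers; rewrite size_cat size_map size_drop; lia.
have := @dfa_pair (take (size be) al ++ p' ++ s') be.
rewrite padR_catl // /dfa_accepts foldl_cat map_cat -ep -es foldl_cat.
move=> /(_ acc) [L' _ e'].
have := mal _ L' (canc _ (tr _ _ _ e' ebe)); rewrite !size_cat e1.
have := congr1 size ed; rewrite size_cat size_drop; lia.
Qed.

End Shortest.

(** * The relation aab = ba *)

Section Affine.
Variables (A : eqType) (a b : A).
Hypothesis ab : a != b.
Let u := [:: a; a; b].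
Let v := [:: b; a].

(* b acts on exponents of a as multiplication by 2. *)
Fixpoint height (w : seq A) : nat :=
  if w is c :: w' then
    if c == a then (height w').+1 else if c == b then 2 * height w' else height w'
  else 0.

(** The normal form a^x b^k: since b a^x = a^(2x) b, the class of a word in a and b is determined by
    its height and its number of letters b. *)
Definition elt x k : seq A := nseq x a ++ nseq k b.

Let rf x : pres_cong u v x x. Proof. exact: rst_refl. Qed.
Let cgl p x y : pres_cong u v x y -> pres_cong u v (p ++ x) (p ++ y).
Proof. by have [_ _ _ cg] := pres_cong_congruence u v; move=> /(cg p [::]); rewrite !cats0. Qed.

Lemma height_cong x y : pres_cong u v x y -> height x = height y.
Proof.
apply: pres_cong_invariant => p s; elim: p => /= [|c p ->] //.
by rewrite !eqxx eq_sym (negbTE ab); lia.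
Qed.

Lemma count_cong x y : pres_cong u v x y -> count_mem b x = count_mem b y.
Proof.
by apply: pres_cong_invariant => p s; rewrite !count_cat /= (negbTE ab).
Qed.

Lemma letters_cong x y : pres_cong u v x y ->
  all (mem [:: a; b]) x = all (mem [:: a; b]) y.
Proof.
by apply: pres_cong_invariant => p s; rewrite !all_cat /= !inE !eqxx !orbT.
Qed.

Lemma double x k : pres_cong u v (b :: elt x k) (elt (2 * x) k.+1).
Proof.
elim: x => [|x IH]; first exact: rf.
apply: rst_trans (rst_sym _ _ _ _ (rst_step _ _ _ _ (RelStep u v [::] (elt x k)))) _.
by rewrite mulnS; apply: (@cgl [:: a; a]).
Qed.

Lemma elt_height w : all (mem [:: a; b]) w ->
  pres_cong u v w (elt (height w) (count_mem b w)).
Proof.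
elim: w => [|c w IH] //=; rewrite !inE => /andP[/orP[/eqP ->|/eqP ->] /IH hw].
  by rewrite eqxx (negbTE ab); apply: (@cgl [:: a]).
rewrite eqxx eq_sym (negbTE ab).
by apply: rst_trans (@cgl [:: b] _ _ hw) _; apply: double.
Qed.

Lemma height_elt x k : height (elt x k) = x.
Proof.
rewrite /elt; elim: x => [|x IH] /=; last by rewrite eqxx IH.
by elim: k => //= k ->; rewrite eq_sym (negbTE ab) eqxx.
Qed.

Lemma elt_mul_b x k : elt x k ++ [:: b] = elt x k.+1.
Proof. by rewrite /elt -catA; congr (_ ++ _); elim: k => //= k ->. Qed.

Lemma elt_mul_a x k : pres_cong u v (elt x k ++ [:: a]) (elt (x + 2 ^ k) k).
Proof.
have h : all (mem [:: a; b]) (elt x k ++ [:: a]).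
  by rewrite /elt !all_cat !all_nseq /= !inE !eqxx !orbT.
have := elt_height h; rewrite !count_cat !count_nseq /= eqxx (negbTE ab) mul0n mul1n !addn0.
suff -> : height (elt x k ++ [:: a]) = x + 2 ^ k by [].
rewrite /elt -catA; elim: x {h} => [|x IH] /=; last by rewrite eqxx IH.
elim: k => [|k IH] /=; first by rewrite eqxx.
by rewrite eq_sym (negbTE ab) eqxx IH !add0n expnS.
Qed.

Lemma elt_cancel x k x' : pres_cong u v (x' ++ [:: b]) (elt x k.+1) ->
  pres_cong u v x' (elt x k).
Proof.
move=> h; have := letters_cong h; rewrite all_cat /elt all_cat !all_nseq /= !inE !eqxx !orbT !andbT.
move=> /elt_height hx.
have e1 := height_cong h; have e2 := count_cong h.
rewrite -elt_mul_b !count_cat in e2.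
have e3 : height (x' ++ [:: b]) = height x'.
  by elim: x' {h hx e1 e2} => /= [|c w ->] //; rewrite eq_sym (negbTE ab) eqxx.
rewrite e3 height_elt in e1; move/addIn: e2 => e2.
rewrite e1 e2 in hx; move: hx; rewrite ?count_cat !count_nseq /= eqxx (negbTE ab).
by rewrite mul0n mul1n.
Qed.

(** Multiplying b^k by a^r costs at most [ka * r] generators and gives a^(2^k r) b^k; removing b^k
    costs at most [kb * k]. So a^(2^k r) has a representative whose length is linear in r with slope
    [ka], while its value has at most [M] times as many letters. *)
Lemma aab_ba_not_automatic : ~ automatic (pres_cong u v).
Proof.
move=> [m [g [L [base auto]]]].
have cong := pres_cong_congruence u v.
have [ca ga] : exists c, g c = [:: a].
  by apply: (letter_generator base); apply/negP => /size_infix.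
have [cb gb] : exists c, g c = [:: b].
  by apply: (letter_generator base); apply/negP => /size_infix.
have [ka [qa [da [Fa Ha]]]] := auto (Some ca).
have [kb [qb [db [Fb Hb]]]] := auto (Some cb).
(* Since 2^k > k = [M * ka], the two bounds on a^(2^k r) conflict for large r; the value of [r]
   chosen below outweighs the constant terms. *)
pose M := \max_c size (g c); pose k := M * ka.
have [al0 s0] := shortest_exists base (elt 0 k).
have grow r al : shortest (pres_cong u v) g L (elt (2 ^ k * r) k) al ->
    size al <= size al0 + ka * r.
  elim: r al => [|r IH] al sal.
    rewrite muln0 in sal; case: sal => _ _ min; case: s0 => L0 e0 _.
    by rewrite muln0 addn0; apply: min.
  have [al' s'] := shortest_exists base (elt (2 ^ k * r) k).
  have : size al <= size al' + ka.
    have [L' e' _] := s'.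
    apply: (shortest_mul cong Ha _ L' e' sal).
    by rewrite ga mulnS addnC; apply: elt_mul_a.
  by have := IH _ s'; rewrite mulnS; lia.
have shrink x j al be : shortest (pres_cong u v) g L (elt x 0) al ->
    shortest (pres_cong u v) g L (elt x j) be -> size al <= size be + kb * j.
  elim: j be => [|j IH] be sal sbe.
    rewrite muln0 addn0; case: sal => _ _ min; case: sbe => Lb eb _; exact: min.
  have [be' s'] := shortest_exists base (elt x j).
  have : size be' <= size be + kb.
    have [Lb eb _] := sbe; apply: (shortest_div cong Hb _ _ Lb eb s').
      by rewrite gb elt_mul_b; apply: rst_refl.
    by move=> x'; rewrite gb; apply: elt_cancel.
  by have := IH _ sal s'; rewrite mulnS; lia.
pose r := (M * size al0 + M * (kb * k)).+1.
have [al sal] := shortest_exists base (elt (2 ^ k * r) 0).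
have [be sbe] := shortest_exists base (elt (2 ^ k * r) k).
have h1 := grow _ _ sbe; have h2 := shrink _ _ _ _ sal sbe.
have h3 : 2 ^ k * r <= M * size al.
  have [_ eal _] := sal; have := ev_size g al.
  have -> : ev g al = elt (2 ^ k * r) 0.
    have nb w : infix w (elt (2 ^ k * r) 0) -> b \notin w.
      rewrite /elt cats0 => /infixP[p [s e]]; apply/negP => bw.
      have : b \in nseq (2 ^ k * r) a by rewrite e !mem_cat bw orbT.
      by rewrite mem_nseq eq_sym (negbTE ab) andbF.
    by apply: (isolated eal).2; apply/negP => /nb; rewrite !inE eqxx ?orbT.
  by rewrite /elt cats0 size_nseq.
have h4 : k < 2 ^ k by apply: ltn_expl.
have : M * size al <= M * (size al0 + ka * r + kb * k) by rewrite leq_mul2l; apply/orP; right; lia.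
move: h3 h4; rewrite /r /k; move: (2 ^ (M * ka)) => p; nia.
Qed.

End Affine.

(** * The relations ab = b and ab = a *)

Section Absorb.
Variables (A : eqType) (a b : A).
Hypothesis ab : a != b.
Let u := [:: a; b].
Let v := [:: b].

Let cgl p x y : pres_cong u v x y -> pres_cong u v (p ++ x) (p ++ y).
Proof. by have [_ _ _ cg] := pres_cong_congruence u v; move=> /(cg p [::]); rewrite !cats0. Qed.

Lemma absorb_count x y : pres_cong u v x y -> count_mem b x = count_mem b y.
Proof.
by apply: pres_cong_invariant => p s; rewrite !count_cat /= (negbTE ab).
Qed.

Lemma absorb_letters x y : pres_cong u v x y ->
  all (mem [:: a; b]) x = all (mem [:: a; b]) y.
Proof.
by apply: pres_cong_invariant => p s; rewrite !all_cat /= !inE !eqxx !orbT.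
Qed.

(** Both sides of the relation end in b, so a step leaves untouched what follows the last b. *)
Lemma absorb_tail x y : pres_cong u v x y -> index b (rev x) = index b (rev y).
Proof.
apply: (@pres_cong_invariant _ _ (fun x => index b (rev x))) => p s.
rewrite !rev_cat -!catA (_ : rev u = [:: b; a]) // (_ : rev v = [:: b]) //.
by rewrite !index_cat !mem_rev; case: (b \in s); rewrite //= !inE !eqxx.
Qed.

Lemma absorb_nseq i s : pres_cong u v (nseq i a ++ b :: s) (b :: s).
Proof.
elim: i => [|i IH]; first exact: rst_refl.
apply: rst_trans (@cgl [:: a] _ _ IH) _.
exact: (rst_step _ _ _ _ (RelStep u v [::] s)).
Qed.

Lemma no_b_nseq x : all (mem [:: a; b]) x -> count_mem b x = 0 -> x = nseq (size x) a.
Proof.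
elim: x => //= c x IH; rewrite !inE => /andP[/orP[/eqP ->|/eqP ->] hx]; last by rewrite eqxx.
by rewrite (negbTE ab) add0n => /(IH hx) {1}->.
Qed.

Lemma first_b x : all (mem [:: a; b]) x -> 0 < count_mem b x ->
  exists i s, x = nseq i a ++ b :: s.
Proof.
elim: x => //= c x IH; rewrite !inE => /andP[/orP[/eqP ->|/eqP ->] hx]; last by exists 0, x.
by rewrite (negbTE ab) add0n => /(IH hx) [i [s ->]]; exists i.+1, s.
Qed.

Lemma absorb_run j x : all (mem [:: a; b]) x -> 0 < count_mem b x ->
  pres_cong u v (nseq j a ++ x) x.
Proof.
move=> hx /(first_b hx) [i [s ->]]; rewrite catA -nseqD.
by apply: rst_trans (absorb_nseq _ _) _; apply: rst_sym; apply: absorb_nseq.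
Qed.

(* Removing a loop from the unmatched initial part of al only removes letters a
   standing to the left of a b, which does not change the element. *)
Lemma ab_b_not_padL m (g : 'I_m -> seq A) L : base_structure (pres_cong u v) g L ->
  ~ (forall c, regular (L_right_padL (pres_cong u v) g L c)).
Proof.
move=> base auto; have [_ _ _ sur] := base.
have [w [_ ew]] := sur [:: b].
(* The letter b need not be a generator, since its class contains other words; but some generator in
   a representative of b contains a b. *)
have [c [ac cc]] : exists c, all (mem [:: a; b]) (g c) /\ 0 < count_mem b (g c).
  have := absorb_letters ew; rewrite /= !inE eqxx orbT => hw.
  have : 0 < count_mem b (ev g w) by rewrite (absorb_count ew) /= eqxx.
  elim: w hw {ew} => //= c w IH; rewrite /ev /= all_cat count_cat => /andP[h1 h2].
  by case: (posnP (count_mem b (g c))) => [->|h]; [rewrite add0n; apply: IH | exists c].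
have [i [tl gc]] := first_b ac cc.
have [k [q0 [d [F HF]]]] := auto (Some c).
(* The first [k] letters of [al] contribute at most Mk letters b, so at least one b remains to the
   right of a loop found there. *)
pose M := \max_x size (g x); pose n := (M * k).+1.
have [be [Lbe ebe]] := sur (nseq n b ++ b :: tl).
(* The final run of letters a has invariant length and forces [al] to have more than |be| + k
   letters, so that its first k letters face padding. *)
pose x := nseq n b ++ nseq (M * (size be + k)).+1 a.
have xc : pres_cong u v (x ++ g c) (nseq n b ++ b :: tl).
  rewrite /x gc -!catA; apply: cgl; rewrite catA -nseqD; exact: absorb_nseq.
have [al [Lal eal min]] := shortest_exists base x.
have hsz : size be + k < size al.
  have e1 := absorb_tail eal; have : index b (rev x) = (M * (size be + k)).+1.
    rewrite /x rev_cat index_cat mem_rev mem_nseq eq_sym (negbTE ab) andbF size_rev size_nseq.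
    by rewrite /n -[(M * k).+1]addn1 nseqD rev_cat /= eqxx addn0.
  rewrite -e1 => e2; have := index_size b (rev (ev g al)); rewrite size_rev e2 => e3.
  rewrite ltnNge; apply/negP => le.
  have := leq_trans e3 (ev_size g al); rewrite -/M ltnNge => /negP; apply.
  by rewrite leq_mul2l le orbT.
have acc : dfa_accepts d q0 F (padL al be).
  apply/HF; exists al, be; split=> //; rewrite ev_cat ev_oseq.
  have [_ sy tr cg] := pres_cong_congruence u v.
  by apply: (tr _ (x ++ g c)); [exact: (cg [::] (g c) _ _ eal) | exact: (tr _ _ _ xc (sy _ _ ebe))].
have [|p [r [s [ep r0 eq]]]] := @dfa_pump _ k d q0
    (map (fun a => (Some a, None)) (take k al)).
  by rewrite size_map size_takel //; lia.
have [p' [r' [s' [et epp err ess]]]] : exists p' r' s', [/\ take k al = p' ++ r' ++ s',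
    p = map (fun a => (Some a, None)) p', r = map (fun a => (Some a, None)) r' &
    s = map (fun a => (Some a, None)) s'].
  exists (take (size p) (take k al)), (take (size r) (drop (size p) (take k al))),
    (drop (size r) (drop (size p) (take k al))).
  rewrite !cat_take_drop map_take [map _ (take (size r) _)]map_take.
  rewrite [map _ (drop (size r) _)]map_drop ![map _ (drop (size p) _)]map_drop ep.
  by rewrite take_size_cat // drop_size_cat // take_size_cat // drop_size_cat.
have hr : 0 < size r' by move: r0; rewrite err size_map.
have sk : size p' + size r' + size s' = k.
  have := congr1 size et; rewrite !size_cat size_takel; last by lia.
  by lia.
pose q := size al - size be.
pose mid := s' ++ drop k (take q al).
have hq : k < q by rewrite /q; lia.
have eal1 : al = p' ++ r' ++ mid ++ drop q al.
  rewrite /mid -{1}(cat_take_drop q al) -{1}(cat_take_drop k (take q al)).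
  have -> : take k (take q al) = take k al by rewrite -take_min (minn_idPl _) // ltnW.
  by rewrite et -!catA.
have hdr : size (drop q al) = size be by rewrite size_drop /q; lia.
pose al' := p' ++ mid ++ drop q al.
have acc' : dfa_accepts d q0 F (padL al' be).
  move: acc; rewrite {1}eal1 /al' /dfa_accepts.
  rewrite -[X in padL X]/(p' ++ r' ++ (mid ++ drop q al)).
  have -> : p' ++ r' ++ mid ++ drop q al = (p' ++ r' ++ mid) ++ drop q al by rewrite -!catA.
  have -> : p' ++ mid ++ drop q al = (p' ++ mid) ++ drop q al by rewrite -!catA.
  rewrite !padL_catl // !map_cat -epp -err !foldl_cat.
  by move: eq; rewrite foldl_cat => ->.
have [al2 [be2 [L2 _ e2 epad]]] := (HF _).2 acc'.
have [p1 p2] := padL_proj al' be; have [p3 p4] := padL_proj al2 be2.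
rewrite epad p3 in p1; rewrite epad p4 in p2; subst al2 be2.
(* The word without the loop still has the product [be], and the number of letters b is invariant:
   the loop evaluates to a power of a. *)
have eC : count_mem b (ev g al' ++ g c) = count_mem b (ev g al ++ g c).
  move: e2; rewrite ev_cat ev_oseq => /absorb_count ->.
  rewrite (absorb_count ebe) -(absorb_count xc).
  have [_ _ _ cg] := pres_cong_congruence u v.
  exact: esym (absorb_count (cg [::] (g c) _ _ eal)).
have la : all (mem [:: a; b]) (ev g al).
  rewrite (absorb_letters eal) /x all_cat !all_nseq /= !inE !eqxx !orbT.
  by [].
have cr : count_mem b (ev g r') = 0.
  by move: eC; rewrite {1}eal1 /al' !ev_cat !count_cat; lia.
have lr : all (mem [:: a; b]) (ev g r').
  by move: la; rewrite {1}eal1 !ev_cat !all_cat => /and3P[].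
have lm : all (mem [:: a; b]) (ev g (mid ++ drop q al)).
  by move: la; rewrite {1}eal1 !ev_cat !all_cat => /and3P[_ _].
have cm : 0 < count_mem b (ev g (mid ++ drop q al)).
  have := absorb_count eal; rewrite {1}eal1 /x !(ev_cat g p') !(ev_cat g r') !count_cat cr !count_nseq.
  rewrite /= eqxx (negbTE ab) mul0n mul1n addn0 add0n.
  have : count_mem b (ev g p') <= M * k.
    apply: leq_trans (count_size _ _) _; apply: leq_trans (ev_size g _) _.
    by rewrite -/M leq_mul2l; apply/orP; right; lia.
  by rewrite /n; lia.
have : pres_cong u v (ev g al') x.
  apply: rst_trans eal; rewrite /al' {2}eal1 !(ev_cat g p') !(ev_cat g r'); apply: cgl.
  by apply: rst_sym; rewrite (no_b_nseq lr cr); apply: absorb_run.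
move=> /(min _ L2); rewrite {1}eal1 /al' !size_cat; lia.
Qed.

Lemma ab_b_not_biautomatic : ~ biautomatic (pres_cong u v).
Proof.
move=> [m [g [L [base bi]]]]; apply: (ab_b_not_padL base) => c.
by case: (bi c).
Qed.

End Absorb.

Lemma pres_cong_rev (A : Type) (u v x y : seq A) :
  pres_cong u v x y -> pres_cong (rev u) (rev v) (rev x) (rev y).
Proof.
elim=> [x' y' [p s]|x'|x' y' _|x' y' z _ h _ h'].
- by rewrite !rev_cat -!catA; apply: rst_step; apply: RelStep.
- exact: rst_refl.
- exact: rst_sym.
- exact: rst_trans h h'.
Qed.

(** Reversal turns ab = a into ba = a, the previous relation with the letters exchanged, and left
    multiplication padded on the right into right multiplication padded on the left. *)
Lemma ab_a_not_biautomatic (A : eqType) (a b : A) : a != b ->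
  ~ biautomatic (pres_cong [:: a; b] [:: a]).
Proof.
move=> ab [m [g [L [[inj ne rL sur] bi]]]].
set E := pres_cong [:: a; b] [:: a] in inj sur bi.
set E' := pres_cong [:: b; a] [:: a].
have EE' x y : E' x y <-> E (rev x) (rev y).
  split=> h; first exact: (pres_cong_rev h).
  by rewrite -[x]revK -[y]revK; apply: (pres_cong_rev h).
have ba : b != a by rewrite eq_sym.
pose g' (c : 'I_m) := rev (g c).
have evr w : ev g' w = rev (ev g (rev w)).
  elim: w => // c w IH; rewrite -cat1s rev_cat !ev_cat rev_cat IH; congr (_ ++ _).
  by rewrite /ev /= !cats0.
apply: (@ab_b_not_padL _ b a ba m g' (fun w => L (rev w))).
  split.
  - by move=> c c' /EE'; rewrite /g' !revK; apply: inj.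
  - by move=> w /ne h ew; apply: h; rewrite ew.
  - exact: regular_rev.
  move=> x; have [w [Lw h]] := sur (rev x).
  by exists (rev w); rewrite evr revK; split=> //; apply/EE'; rewrite revK.
move=> c; case: (bi c) => _ _ /regular_rev + _; apply: eq_regular => w.
split=> -[s [t [h1 h2 h3 h4]]].
  exists (rev s), (rev t); rewrite !revK; split=> //; last by rewrite -[w]revK h4 /padL !revK.
  by apply/EE'; rewrite !evr !revK rev_cat revK; case: (c) h3.
exists (rev s), (rev t); split=> //; last by rewrite h4 /padL revK.
by move/EE': h3; rewrite !evr !revK rev_cat; case: (c).
Qed.

Theorem theorem3p2p6 (n : nat) (u v : seq 'I_n) :
  2 <= n -> size v <= size u -> size u <= 3 ->
  (* (1) *)
  ((~ bad_rel1 u v -> prefix_automatic (pres_cong u v)) /\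
   (bad_rel1 u v -> ~ automatic (pres_cong u v))) /\
  (* (2) *)
  ((((size u = 3 /\ size v = 0) \/ (size u = 3 /\ size v = 3) \/
     (size u = 2 /\ ~ bad_rel2 u v)) -> biautomatic (pres_cong u v)) /\
   (size u = 2 -> bad_rel2 u v -> ~ biautomatic (pres_cong u v))).
Proof.
move=> n2 vu u3; split; split.
- exact: positive_prefix_automatic.
- move=> [a [b [/eqP ab h]]]; case: h => -[-> ->].
  + exact: aba_ba_not_automatic.
  + exact: aab_ba_not_automatic.
  + exact: abb_bb_not_automatic.
- exact: positive_biautomatic.
- move=> _ [a [b [/eqP ab h]]]; case: h => -[-> ->].
  + exact: ab_a_not_biautomatic.
  + exact: ab_b_not_biautomatic.
Qed.
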